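(* Assume that the distribution of $\xi$ is nonlattice and $m:=\mathbb{E}\xi<\infty$. Then, for fixed $j\in\mathbb{N}$ and fixed $h>0$, $$V_j(t+h)-V_j(t)\ \sim\ \frac{h\,t^{j-1}}{(j-1)!\,m^j},\qquad t\to\infty,$$ that is, the ratio of the two sides converges to $1$ as $t\to\infty$.
   Context: Let $(\xi_i,\eta_i)_{i\in\mathbb{N}}$ be independent copies of a random vector $(\xi,\eta)$ whose components are a.s. positive and arbitrarily dependent. Put $S_0:=0$, $S_i:=\xi_1+\cdots+\xi_i$ and $T_i:=S_{i-1}+\eta_i$ for $i\in\mathbb{N}$; the sequence $T:=(T_i)_{i\in\mathbb{N}}$ is called a perturbed random walk. General branching process generated by $T$: at time $0$ there is one individual, the ancestor, whose children (the first generation) have birth times given by the points of $T$. The individuals of the $(j-1)$th generation produce the $j$th generation: the shifts of the birth times of the children of an individual with respect to that individual's birth time are distributed as a copy of $T$, the copies for different mothers being independent of each other and of the past. Formally, let $T^{(u)}=(T^{(u)}_i)_{i\in\mathbb{N}}$, $u\in\bigcup_{n\ge 0}\mathbb{N}^n$, be independent copies of $T$; the $j$th generation individual $u=(u_1,\ldots,u_j)\in\mathbb{N}^j$ has birth time $\sum_{i=1}^j T^{((u_1,\ldots,u_{i-1}))}_{u_i}$. For $j\in\mathbb{N}$ and $t\ge 0$, $N_j(t)$ denotes the number of $j$th generation individuals with birth times $\le t$, and $V_j(t):=\mathbb{E}N_j(t)$ (with $V_j(t):=0$ for $t<0$). The distribution of a positive random variable is called nonlattice if it is not concentrated on any lattice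 $(nd)_{n\in\mathbb{N}_0}$, $d>0$, where $\mathbb{N}_0=\mathbb{N}\cup\{0\}$. *)

(* Defs.v *)
From HB Require Import structures.
From mathcomp Require Import all_boot all_order all_algebra finmap.
From mathcomp Require Import all_classical all_reals all_analysis.

Set Implicit Arguments.
Unset Strict Implicit.
Unset Printing Implicit Defensive.

Import Order.TTheory GRing.Theory Num.Theory.
Import numFieldNormedType.Exports.

Local Open Scope classical_set_scope.
Local Open Scope ring_scope.

Definition identically_distributed (d d' : measure_display)
    (Omega : measurableType d) (S : measurableType d') (R : realType)
    (P : probability Omega R) (X Y : Omega -> S) : Prop :=
  forall A : set S, measurable A -> P (X @^-1` A) = P (Y @^-1` A).

Definition mutually_independent (d d' : measure_display)
    (Omega : measurableType d) (S : measurableType d') (R : realType)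
    (P : probability Omega R) (I : choiceType) (X : I -> Omega -> S) : Prop :=
  forall (J : {fset I}) (A : I -> set S),
    (forall i, i \in J -> measurable (A i)) ->
    P (\bigcap_(i in [set` J]) X i @^-1` A i)
      = (\prod_(i <- J) P (X i @^-1` A i))%E.

Definition independent_copies (d d' : measure_display)
    (Omega : measurableType d) (S : measurableType d') (R : realType)
    (P : probability Omega R) (I : choiceType)
    (Y : Omega -> S) (X : I -> Omega -> S) : Prop :=
  mutually_independent P X /\
  forall i, identically_distributed P (X i) Y.

Definition coordinate_sets (R : realType) : set (set (nat -> R)) :=
  [set C | exists (i : nat) (B : set R),
     measurable B /\ C = [set x | B (x i)]].

(* The space of real sequences with the product sigma-algebra. *)
Definition real_sequences (R : realType) :=
  g_sigma_algebraType (@coordinate_sets R).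

Definition as_random_sequence (R : realType) (Omega : Type)
    (T : nat -> Omega -> R) : Omega -> real_sequences R :=
  fun w i => T i w.

Definition nonlattice (R : realType) (mu : set R -> \bar R) : Prop :=
  forall d : R, 0 < d -> mu (range (fun n : nat => n%:R * d)) != 1%E.

(* Positions are numbered from 0: xi i, eta i and perturbed_walk xi eta i
   stand for $\xi_{i+1}$, $\eta_{i+1}$ and $T_{i+1} = S_i + \eta_{i+1}$. *)
Definition perturbed_walk (R : realType) (Omega : Type)
    (xi eta : nat -> Omega -> R) (i : nat) (w : Omega) : R :=
  \sum_(k < i) xi k w + eta i w.

Section branching_process.
Context (R : realType) (d : measure_display) (Omega : measurableType d).
Variables (P : probability Omega R) (T : seq nat -> nat -> Omega -> R).

(* Individuals are finite words over nat, the ancestor being the empty word;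
   T u i is the age of u at the birth of its child rcons u i. *)
Definition birth_time (j : nat) (u : j.-tuple nat) (w : Omega) : R :=
  \sum_(i < j) T (take i u) (tnth u i) w.

Definition generation_count (j : nat) (t : R) (w : Omega) : \bar R :=
  counting [set u : j.-tuple nat | birth_time u w <= t].

Definition mean_generation_count (j : nat) (t : R) : \bar R :=
  if t < 0 then 0%E else (\int[P]_w generation_count j t w)%E.

End branching_process.

(* Main.v *)
Require Import Defs.
From HB Require Import structures.
From mathcomp Require Import all_boot all_order all_algebra finmap.
From mathcomp Require Import all_classical all_reals all_analysis.
From mathcomp Require Import measurable_realfun ring lra.

Import Order.TTheory GRing.Theory Num.Theory.
Import numFieldNormedType.Exports.

Local Open Scope classical_set_scope.
Local Open Scope ring_scope.

Set Implicit Arguments.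
Unset Strict Implicit.
Unset Printing Implicit Defensive.

(** For a function f on the line put
      W f (t) = E (sum over i of f (t - T_i)),
    and let H be the unit step at 0. The birth time of an individual is a sum of
    independent terms distributed as T_i, one for each letter of its word, so the
    mean number of individuals of generation j born up to t is V_j = W^j H
    ([esum_generation], [mean_generation_countE]). Since T_i is a sum of i
    copies of xi and one of eta, all independent, W is the sum over i of A^i B, where A
    and B are the convolutions with the laws of xi and eta. The proof only
    handles such positive, translation invariant, causal operators ([convop]).

    The case j = 1 is Blackwell's renewal theorem ([blackwell]): W 1_[0,h[ tends
    to h / m at infinity. The interval is replaced by a tent z of width 2 d. Then
    Z = W z is bounded, uniformly continuous, and Z - A Z = B z vanishes at
    infinity. If Z (t) is close to the limit superior of Z, averaging shows that
    Z (t - x) is close to it for every x in the support of the law of xi, hence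
    for every x in the semigroup generated by this support. As the law is
    nonlattice, this semigroup is asymptotically dense
    ([semigroup_asymptotically_dense]), and Z is close to its limit superior on
    arbitrarily long grids ([limsup_window]). The value of the limit comes from
    a function on which W is explicit: g (x) = P (xi > x) for x >= 0 satisfies
    g + A H = H, so the renewal series telescopes and W g = B H, which is at most 1
    and tends to 1 ([renewal_survival]). Comparing g with the sum of the
    g (k d) z (. - k d), and m with d times the sum of the g (k d), yields
      limsup Z <= d / (m - 2 d)   and   liminf Z >= d / (m + 2 d)
    ([bump_mass_hi], [bump_mass_lo]; the limit inferior of Z is treated as the
    limit superior of C - Z). An interval of length n d lies between a sum of n - 1 and
    a sum of n + 1 tents, and d tends to 0.

    For larger j, V_(j+1) (t) - V_(j+1) (t - h) = W^j (W 1_[0,h[) (t). By Blackwell's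
    theorem W 1_[0,h[ is (h / m) H up to a small multiple of H and a bounded
    function with support in a fixed interval [0, S[ ([renewal_box_squeeze]).
    Applying W^j, the main term becomes (h / m) V_j (t) and the local error becomes
    an increment of V_j, which is of lower order by induction. The growth of V_j
    follows from that of its increments by a Stolz-Cesaro argument
    ([stolz_monomial]). *)


(** * Convolution operators on the line *)

Section operators.
Context {R : realType}.
Local Open Scope ereal_scope.
Implicit Types (f g : R -> \bar R) (W : (R -> \bar R) -> R -> \bar R).

Definition nnmeas f := measurable_fun [set: R] f /\ forall x, 0 <= f x.

(** The properties of convolution with a positive measure carried by the half-line
    that the proof relies on. Working with operators instead of measures, the sums
    and iterates below, which correspond to infinite measures, need no
    construction of their own. *)
Record convop W : Prop := ConvOp {
  convop_nnmeas : forall f, nnmeas f -> nnmeas (W f) ;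
  convop_le : forall f g t, nnmeas f -> nnmeas g ->
    (forall x, f x <= g x) -> W f t <= W g t ;
  convop_add : forall f g t, nnmeas f -> nnmeas g ->
    W (fun x => f x + g x) t = W f t + W g t ;
  convop_scale : forall (k : R) f t, nnmeas f -> (0 <= k)%R ->
    W (fun x => k%:E * f x) t = k%:E * W f t ;
  convop_series : forall (f_ : nat -> R -> \bar R) t,
    (forall n, nnmeas (f_ n)) ->
    W (fun x => \sum_(n <oo) f_ n x) t = \sum_(n <oo) W (f_ n) t ;
  convop_shift : forall f a t, nnmeas f ->
    W (fun x => f (x + a)%R) t = W f (t + a)%R ;
  convop_causal : forall f t, nnmeas f -> (forall x, (x < 0)%R -> f x = 0) ->
    (t < 0)%R -> W f t = 0 }.

Lemma nnmeasD f g : nnmeas f -> nnmeas g -> nnmeas (fun x => f x + g x).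
Proof.
move=> [mf f0] [mg g0]; split; first exact: emeasurable_funD.
by move=> x; rewrite adde_ge0.
Qed.

Lemma nnmeasZ (k : R) f : (0 <= k)%R -> nnmeas f -> nnmeas (fun x => k%:E * f x).
Proof.
move=> k0 [mf f0]; split; first exact: measurable_funeM.
by move=> x; rewrite mule_ge0.
Qed.

Lemma nnmeas_series (f_ : nat -> R -> \bar R) : (forall n, nnmeas (f_ n)) ->
  nnmeas (fun x => \sum_(n <oo) f_ n x).
Proof.
move=> mf; split.
  by apply: ge0_emeasurable_sum => // [k x _ _|k _]; [exact: (mf k).2|exact: (mf k).1].
by move=> x; apply: nneseries_ge0 => n _ _; exact: (mf n).2.
Qed.

Lemma nnmeas_shift f a : nnmeas f -> nnmeas (fun x => f (x + a)%R).
Proof.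
move=> [mf f0]; split => //; apply: measurableT_comp => //.
exact: measurable_funD.
Qed.

Lemma nnmeas_sum (n : nat) (f_ : nat -> R -> \bar R) : (forall k, nnmeas (f_ k)) ->
  nnmeas (fun x => \sum_(k < n) f_ k x).
Proof.
move=> mf; split.
  by apply: emeasurable_sum => k; exact: (mf k).1.
by move=> x; apply: sume_ge0 => k _; exact: (mf k).2.
Qed.

Definition conv (mu : {measure set R -> \bar R}) f (t : R) : \bar R :=
  \int[mu]_y f (t - y)%R.

Lemma nnmeas_reflect f t : nnmeas f -> nnmeas (fun y => f (t - y)%R).
Proof.
move=> [mf f0]; split => //; apply: measurableT_comp => //.
by apply: measurable_funB.
Qed.

Lemma measurable_difference : measurable_fun setT (fun z : R * R => z.1 - z.2)%R.
Proof. exact: measurable_funB. Qed.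

(** Causality is where the half-line enters: for t < 0 the point t - y is negative
    for every y charged by F. *)
Lemma conv_convop (F : probability R R) : F `]-oo, 0%R[%classic = 0 -> convop (conv F).
Proof.
move=> F0; split.
- move=> f [mf f0]; split; last by move=> x; exact: integral_ge0.
  apply: (measurable_fun_fubini_tonelli_F (m2 := F) (fun z : R * R => f (z.1 - z.2)%R)) => //.
  by apply: measurableT_comp => //; exact: measurable_difference.
- move=> f g t /(nnmeas_reflect t)[mf f0] /(nnmeas_reflect t)[mg g0] fg.
  by apply: ge0_le_integral.
- move=> f g t /(nnmeas_reflect t)[mf f0] /(nnmeas_reflect t)[mg g0].
  by rewrite /conv ge0_integralD.
- move=> k f t /(nnmeas_reflect t)[mf f0] k0.
  by rewrite /conv ge0_integralZl.
- move=> f t mf; rewrite /conv integral_nneseries//.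
  + by move=> n; exact: (nnmeas_reflect t (mf n)).1.
  + by move=> n x _; exact: (mf n).2.
- move=> f a t mf; rewrite /conv; apply: eq_integral => y _.
  by congr f; ring.
- move=> f t mf f0 t0; have [mft ft0] := nnmeas_reflect t mf.
  rewrite /conv -(setUv `]-oo, 0%R[%classic) ge0_integral_setU//; last 3 first.
  + exact: measurableC.
  + by rewrite setUv.
  + by rewrite /disj_set setICr.
  rewrite null_set_integral//; last exact: measurable_funS mft.
  rewrite add0e integral0_eq// => y /= /negP; rewrite in_itv/= -leNgt => y0.
  by apply: f0; lra.
Qed.

(** Tonelli: both sides integrate f (t - x - y) over the product law. *)
Lemma convC (F G : probability R R) f : nnmeas f ->
  conv F (conv G f) = conv G (conv F f).
Proof.
move=> [mf f0]; apply/funext => t; rewrite /conv.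
rewrite (fubini_tonelli (fun z : R * R => f (t - z.1 - z.2)%R))//=.
  by apply: eq_integral => y _; apply: eq_integral => x _; congr f; ring.
apply: measurableT_comp => //.
by apply: measurable_funB => //; exact: measurable_funB.
Qed.

Lemma convop_id : convop id.
Proof. by split => // f t mf f0 t0; exact: f0. Qed.

Lemma convop_comp W W' : convop W -> convop W' -> convop (W \o W').
Proof.
move=> cW cW'; have n := convop_nnmeas cW'; split => /=.
- by move=> f /n; exact: convop_nnmeas.
- by move=> f g t mf mg fg; apply: (convop_le cW) => [||x]; [exact: n..|exact: convop_le].
- move=> f g t mf mg; rewrite -(convop_add cW); [|exact: n..].
  congr (W _ t).
  by apply/funext => x; exact: convop_add.
- move=> k f t mf k0; rewrite -(convop_scale cW)//; last exact: n.
  congr (W _ t).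
  by apply/funext => x; exact: convop_scale.
- move=> f t mf; rewrite -(convop_series cW); last by move=> k; exact: n.
  by congr (W _ t); apply/funext => x; exact: convop_series.
- move=> f a t mf; rewrite -(convop_shift cW); last exact: n.
  congr (W _ t).
  by apply/funext => x; exact: convop_shift.
- move=> f t mf f0 t0; apply: (convop_causal cW) => //; first exact: n.
  by move=> x x0; exact: (convop_causal cW').
Qed.

Lemma convop_iter W k : convop W -> convop (fun f => iter k W f).
Proof.
move=> cW; elim: k => [|k IH]; first exact: convop_id.
exact: (convop_comp cW IH).
Qed.

Lemma convop_nneseries (W_ : nat -> (R -> \bar R) -> R -> \bar R) :
  (forall n, convop (W_ n)) -> convop (fun f t => \sum_(n <oo) W_ n f t).
Proof.
move=> cW; have n k := convop_nnmeas (cW k).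
split.
- by move=> f mf; apply: nnmeas_series => k; exact: n.
- move=> f g t mf mg fg; apply: lee_nneseries => k _; first by move=> _; exact: (n k f mf).2.
  exact: convop_le.
- move=> f g t mf mg; rewrite -nneseriesD.
  + by apply: eq_eseriesr => k _; exact: convop_add.
  + by move=> k _ _; exact: (n k f mf).2.
  + by move=> k _ _; exact: (n k g mg).2.
- move=> k f t mf k0; rewrite -nneseriesZl//.
  + by apply: eq_eseriesr => i _; exact: convop_scale.
  + by move=> i _; exact: (n i f mf).2.
- move=> f t mf.
  rewrite nneseries_interchange; last by move=> i j; exact: (n _ _ (mf _)).2.
  by apply: eq_eseriesr => k _; exact: convop_series.
- by move=> f a t mf; apply: eq_eseriesr => k _; exact: convop_shift.
- by move=> f t mf f0 t0; apply: eseries0 => k _ _; exact: (convop_causal (cW k)).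
Qed.

Lemma convop_sum W (n : nat) (f_ : nat -> R -> \bar R) t : convop W ->
  (forall k, nnmeas (f_ k)) ->
  W (fun x => \sum_(k < n) f_ k x) t = \sum_(k < n) W (f_ k) t.
Proof.
move=> cW mf; elim: n => [|n IH].
  have -> : (fun x => \sum_(k < 0) f_ k x) = (fun x => 0%:E * f_ 0%N x).
    by apply/funext => x; rewrite big_ord0 mul0e.
  by rewrite big_ord0 (convop_scale cW)// mul0e.
rewrite big_ord_recr/= -IH -convop_add//; last exact: nnmeas_sum.
by congr (W _ t); apply/funext => x; rewrite big_ord_recr.
Qed.

End operators.

(** * Sums of independent variables *)

Section sum_of_independent.
Context {R : realType} d (Omega : measurableType d) (P : probability Omega R).

(** The law of (X, Y) under P and its law under P conditioned by E agree with the
    product of the two laws on rectangles, hence everywhere by uniqueness of product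
    measures. An event E of probability zero makes both sides vanish. *)
Lemma independent_pair_event (X Y : {RV P >-> R}) (E : set Omega) (C : set (R * R)) :
  measurable E ->
  (forall A B, measurable A -> measurable B ->
     P (X @^-1` A `&` Y @^-1` B) = P (X @^-1` A) * P (Y @^-1` B))%E ->
  (forall A B, measurable A -> measurable B ->
     P (X @^-1` A `&` Y @^-1` B `&` E) = P (X @^-1` A) * P (Y @^-1` B) * P E)%E ->
  measurable C ->
  (P ([set w | C (X w, Y w)] `&` E) = P [set w | C (X w, Y w)] * P E /\
   P [set w | C (X w, Y w)] = (distribution P X \x distribution P Y)%E C)%E.
Proof.
move=> mE XY XYE mC.
have mXY : measurable_fun setT (fun w => (X w, Y w)) by exact: measurable_fun_pair.
have all : P [set w | C (X w, Y w)] = (distribution P X \x distribution P Y)%E C.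
  symmetry; apply: (@product_measure_unique _ _ _ _ _ (distribution P X) (distribution P Y)
    (pushforward P (fun w => (X w, Y w)))) => // A B mA mB; exact: XY.
split => //; have [PE0|PE0] := eqVneq (P E) 0%E.
  rewrite PE0 mule0; apply/eqP; rewrite -measure_le0 -PE0; apply: le_measure; rewrite ?inE//.
  by apply: measurableI => //; rewrite -[X in measurable X]setTI; exact: mXY.
have Efin : P E \is a fin_num by exact: fin_num_measure.
have c0 : 0 < fine (P E).
  by rewrite fine_gt0// lt_neqAle eq_sym PE0 measure_ge0/= ltey_eq Efin.
have k0 : 0 <= (fine (P E))^-1 by rewrite invr_ge0 ltW.
pose k : {nonneg R} := NngNum k0.
have Pk : (P E * k%:num%:E = 1)%E.
  by rewrite /= -{1}[P E]fineK// -EFinM mulfV// gt_eqF.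
have sc : mscale k (pushforward (mrestr P mE) (fun w => (X w, Y w))) C
    = (distribution P X \x distribution P Y)%E C.
  symmetry; apply: (@product_measure_unique _ _ _ _ _ (distribution P X) (distribution P Y)
    (mscale k (pushforward (mrestr P mE) (fun w => (X w, Y w))))) => // A B mA mB.
  change (k%:num%:E * P (X @^-1` A `&` Y @^-1` B `&` E) = P (X @^-1` A) * P (Y @^-1` B))%E.
  by rewrite XYE// muleC -muleA Pk mule1.
have {}sc : (k%:num%:E * P ([set w | C (X w, Y w)] `&` E) = P [set w | C (X w, Y w)])%E.
  by rewrite all; exact: sc.
rewrite -[LHS]mul1e -Pk -muleA sc.
by rewrite muleC.
Qed.


Lemma integral_independent_sum (X Y : {RV P >-> R}) (f : R -> \bar R) t :
  (forall A B, measurable A -> measurable B ->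
     P (X @^-1` A `&` Y @^-1` B) = P (X @^-1` A) * P (Y @^-1` B))%E ->
  nnmeas f ->
  (\int[P]_w f (t - (X w + Y w))%R = \int[P]_w conv (distribution P Y) f (t - X w)%R)%E.
Proof.
move=> XY [mf f0].
have mXY : measurable_fun setT (fun w => (X w, Y w)) by exact: measurable_fun_pair.
pose g (z : R * R) := f (t - (z.1 + z.2)).
have mg : measurable_fun setT g.
  apply: measurableT_comp => //; apply: measurable_funB => //; exact: measurable_funD.
have g0 z : (0 <= g z)%E by exact: f0.
transitivity (\int[pushforward P (fun w => (X w, Y w))]_z g z)%E.
  by rewrite ge0_integral_pushforward.
transitivity (\int[(distribution P X \x distribution P Y)%E]_z g z)%E.
  apply: eq_measure_integral => C mC _; rewrite [RHS](product_measure_unique (m' := pushforward P (fun w => (X w, Y w))))//.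
rewrite fubini_tonelli1// /fubini_F/=.
rewrite (@ge0_integral_distribution _ _ _ _ _ P X (fun x => \int[distribution P Y]_y g (x, y))%E)//; last 2 first.
- exact: (measurable_fun_fubini_tonelli_F (m2 := distribution P Y) g mg g0).
- by move=> x; exact: integral_ge0.
apply: eq_integral => w _ /=; apply: eq_integral => y _.
by rewrite /g/= opprD addrA.
Qed.

Section prefix_sums.
Variables (X : nat -> {RV P >-> R}) (N : nat).

Lemma measurable_prefix_sum n : measurable_fun setT (fun w => \sum_(k < n) X k w).
Proof. by apply: measurable_sum. Qed.

Definition prefix_sum n : {RV P >-> R} := HB.pack_for {mfun Omega >-> R}
  (fun w => \sum_(k < n) X k w)
  (isMeasurableFun.Build _ _ _ _ (fun w => \sum_(k < n) X k w) (measurable_prefix_sum n)).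

(** The product rule is only asked of the whole block of indices below N: for other
    blocks it follows by taking A k = setT. *)
Definition independent_below := forall A : nat -> set R, (forall k, measurable (A k)) ->
  P [set w | forall k, (k < N)%N -> A k (X k w)] = (\prod_(0 <= k < N) P (X k @^-1` A k))%E.

Hypothesis X_indep : independent_below.

Let later (n : nat) (A : nat -> set R) := [set w | forall k, (n <= k < N)%N -> A k (X k w)].

Let measurable_later n A : (forall k, measurable (A k)) -> measurable (later n A).
Proof.
move=> mA; have -> : later n A = (\bigcap_(k in [set k | (n <= k < N)%N]) (X k @^-1` A k))%classic.
  by apply/seteqP; split => w h k; apply: h.
apply: bigcap_measurableType => k _.
by rewrite -[X in measurable X]setTI; apply: (measurable_funP (X k)).
Qed.

Let update (A : nat -> set R) n (B : set R) k := if k == n then B else A k.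

(** The induction merges X n into the partial sum. The events on the later variables
    are carried along because the next step needs the new partial sum to be
    independent of them. *)
Let prefix_sum_indep n (A : nat -> set R) B : (n <= N)%N ->
  (forall k, measurable (A k)) -> measurable B ->
  P (prefix_sum n @^-1` B `&` later n A)
    = (P (prefix_sum n @^-1` B) * \prod_(n <= k < N) P (X k @^-1` A k))%E.
Proof.
elim: n A B => [|n IH] A B nN mA mB.
  have -> : later 0 A = [set w | forall k, (k < N)%N -> A k (X k w)] by [].
  have S0 w : prefix_sum 0 w = 0 by rewrite /prefix_sum /= big_ord0.
  have [B0|B0] := pselect (B 0).
    have -> : prefix_sum 0 @^-1` B = setT by apply/seteqP; split => // w _; change (B (prefix_sum 0 w)); rewrite S0.
    by rewrite setTI X_indep// probability_setT mul1e.
  have -> : prefix_sum 0 @^-1` B = set0 by apply/seteqP; split => // w; change (B (prefix_sum 0 w) -> False); rewrite S0.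
  by rewrite set0I measure0 mul0e.
have mup A' C : (forall k, measurable (A' k)) -> measurable C ->
    forall k, measurable (update A' n C k).
  by move=> mA' mC k; rewrite /update; case: eqP.
have upE A' C : later n (update A' n C) = (X n @^-1` C) `&` later n.+1 A'.
  apply/seteqP; split => w.
    move=> h; split; first by have := h n; rewrite /update eqxx leqnn; apply.
    by move=> k /andP[nk kN]; have := h k; rewrite /update gtn_eqF// (ltnW nk) kN; apply.
  move=> [h1 h2] k /andP[nk kN]; rewrite /update; case: eqP => [->//|/eqP kn].
  by apply: h2; rewrite kN andbT ltn_neqAle eq_sym kn.
have upP A' C : (\prod_(n <= k < N) P (X k @^-1` update A' n C k) =
    P (X n @^-1` C) * \prod_(n.+1 <= k < N) P (X k @^-1` A' k))%E.
  rewrite big_ltn// /update eqxx; congr (_ * _)%E.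
  by rewrite !big_nat; apply: eq_bigr => k /andP[nk _]; rewrite gtn_eqF.
pose AT : nat -> set R := fun=> setT.
have PE : P (later n.+1 A) = (\prod_(n.+1 <= k < N) P (X k @^-1` A k))%E.
  have := IH (update A n setT) setT (ltnW nN) (mup _ _ mA measurableT) measurableT.
  by rewrite upE upP !preimage_setT !setTI probability_setT !mul1e.
have XYE C D : measurable C -> measurable D ->
    (P (prefix_sum n @^-1` C `&` X n @^-1` D `&` later n.+1 A) =
     P (prefix_sum n @^-1` C) * P (X n @^-1` D) * P (later n.+1 A))%E.
  by move=> mC mD; rewrite -setIA -upE IH//; [rewrite upP PE muleA|exact: ltnW|exact: mup].
have XY C D : measurable C -> measurable D ->
    (P (prefix_sum n @^-1` C `&` X n @^-1` D) =
     P (prefix_sum n @^-1` C) * P (X n @^-1` D))%E.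
  move=> mC mD; have := IH (update AT n D) C (ltnW nN) (mup _ _ (fun=> measurableT) mD) mC.
  rewrite upE upP [later n.+1 AT](_ : _ = setT); last by apply/seteqP; split.
  rewrite setIT => ->; rewrite [X in (_ * (_ * X))%E]big1 ?mule1// => k _.
  by rewrite preimage_setT probability_setT.
have mC : measurable [set z : R * R | B (z.1 + z.2)].
  rewrite -[X in measurable X]setTI.
  have : measurable_fun setT (fun z : R * R => z.1 + z.2) by exact: measurable_funD.
  by apply.
have [H _] := independent_pair_event (measurable_later n.+1 mA) XY XYE mC.
have SE : prefix_sum n.+1 @^-1` B = [set w | [set z : R * R | B (z.1 + z.2)] (prefix_sum n w, X n w)].
  by apply/seteqP; split => w; rewrite /preimage/prefix_sum/= big_ord_recr.
by rewrite SE H PE.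
Qed.

(** The last summand becomes a convolution acting on f. Going down from the last
    index, the law of a partial sum thus acts as a composition of convolutions. *)
Lemma integral_prefix_sumS n (f : R -> \bar R) t : (n < N)%N -> nnmeas f ->
  (\int[P]_w f (t - prefix_sum n.+1 w)%R =
   \int[P]_w conv (distribution P (X n)) f (t - prefix_sum n w)%R)%E.
Proof.
move=> nN mf; rewrite -integral_independent_sum//.
  by apply: eq_integral => w _; rewrite /prefix_sum/= big_ord_recr.
move=> C D mC mD.
pose A k : set R := if k == n then D else setT.
have mA k : measurable (A k) by rewrite /A; case: eqP.
have := prefix_sum_indep (ltnW nN) mA mC.
rewrite big_ltn// {2}/A eqxx [X in (_ * (_ * X))%E]big_nat big1 ?mule1; last first.
  by move=> k /andP[nk _]; rewrite /A gtn_eqF// preimage_setT probability_setT.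
move=> <-; congr (P (_ `&` _)); apply/seteqP; split => w.
  by move=> Dw k _; rewrite /A; case: eqP => [->|].
by move=> /(_ n); rewrite /A eqxx leqnn nN; apply.
Qed.

End prefix_sums.
End sum_of_independent.

(** * The law of the perturbed random walk *)

Section independent_family.
Context {R : realType} d d' (Omega : measurableType d) (S : measurableType d')
  (P : probability Omega R).

Lemma mutually_independent_below (I : choiceType) (X : I -> Omega -> S) (g : nat -> I)
    (A : I -> set S) N : mutually_independent P X ->
  {in gtn N &, injective g} -> (forall i, measurable (A i)) ->
  P [set w | forall k, (k < N)%N -> A (g k) (X (g k) w)]
    = (\prod_(0 <= k < N) P (X (g k) @^-1` A (g k)))%E.
Proof.
move=> Xi gi mA.
pose J := [fset g (val k) | k in 'I_N]%fset.
have := Xi J A (fun i _ => mA i).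
have -> : \bigcap_(i in [set` J]) X i @^-1` A i = [set w | forall k, (k < N)%N -> A (g k) (X (g k) w)].
  apply/seteqP; split => w /= h.
    by move=> k kN; apply: (h (g k)); apply/imfsetP; exists (Ordinal kN).
  by move=> i /= /imfsetP[k _ ->]; exact: (h _ (ltn_ord k)).
move=> ->; rewrite big_imfset/=; last first.
  by move=> k l _ _ /gi kl; apply/val_inj/kl; exact: ltn_ord.
by rewrite big_enum/= big_mkord.
Qed.

End independent_family.

Section conv_distribution.
Context {R : realType} d (Omega : measurableType d) (P : probability Omega R).

Lemma conv_distribution (X : {RV P >-> R}) f t : nnmeas f ->
  conv (distribution P X) f t = (\int[P]_w f (t - X w)%R)%E.
Proof.
move=> mf; have [mr r0] := nnmeas_reflect t mf.
by rewrite /conv (ge0_integral_distribution X mr r0).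
Qed.

Lemma eq_conv_distribution (X Y : {RV P >-> R}) f :
  (forall B, measurable B -> P (X @^-1` B) = P (Y @^-1` B)) ->
  conv (distribution P X) f = conv (distribution P Y) f.
Proof.
move=> XY; apply/funext => t; apply: eq_measure_integral => B mB _.
exact: XY.
Qed.

End conv_distribution.

Section walk.
Context {R : realType} d (Omega : measurableType d) (P : probability Omega R).
Variables (xi eta : {RV P >-> R}) (xis etas : nat -> {RV P >-> R}).
Hypothesis copies : independent_copies P (fun w => (xi w, eta w))
         (fun (i : nat) w => (xis i w, etas i w)).

Let A := conv (distribution P xi).
Let B := conv (distribution P eta).

Let xis_law k C : measurable C -> P (xis k @^-1` C) = P (xi @^-1` C).
Proof.
move=> mC; have := copies.2 k _ (measurableX mC measurableT).
have E (Z Z' : {RV P >-> R}) : (fun w => (Z w, Z' w)) @^-1` (C `*` setT) = Z @^-1` C.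
  by apply/seteqP; split => w; [case|].
by rewrite !E.
Qed.

Let etas_law k C : measurable C -> P (etas k @^-1` C) = P (eta @^-1` C).
Proof.
move=> mC; have := copies.2 k _ (measurableX measurableT mC).
have E (Z Z' : {RV P >-> R}) : (fun w => (Z w, Z' w)) @^-1` (setT `*` C) = Z' @^-1` C.
  by apply/seteqP; split => w; [case|].
by rewrite !E.
Qed.

(** The terms of [perturbed_walk xis etas i], with etas i in last position. The variable
    xis i, on which etas i may depend, is not among them. *)
Let summand i (k : nat) : {RV P >-> R} := if (k < i)%N then xis k else etas k.

Let summand_indep i : independent_below (summand i) i.+1.
Proof.
move=> C mC.
pose D k : set (R * R) := if (k < i)%N then C k `*` setT else setT `*` C k.
have mD k : measurable (D k) by rewrite /D; case: ifP => _; exact: measurableX.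
have E k : (fun w => (xis k w, etas k w)) @^-1` D k = summand i k @^-1` C k.
  by rewrite /D /summand; case: ifP => _; apply/seteqP; split => w; [case| |case|].
have := mutually_independent_below (g := id) (N := i.+1) copies.1 (fun _ _ _ _ => id) mD.
under eq_bigr do rewrite E.
move=> <-; congr (P _); apply/seteqP; split => w h k /h.
  by rewrite -[C k _]/((summand i k @^-1` C k) w) -E.
by rewrite -[X in X -> _]/(((fun w => (xis k w, etas k w)) @^-1` D k) w) E.
Qed.

Definition walk i : {RV P >-> R} := prefix_sum (summand i) i.+1.

Lemma walkE i w : walk i w = perturbed_walk xis etas i w.
Proof.
rewrite /walk /prefix_sum /perturbed_walk /= big_ord_recr /=.
by rewrite /summand ltnn; congr (_ + _); apply: eq_bigr => k _; rewrite ltn_ord.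
Qed.

Lemma conv_walk (A_conv : convop A) (B_conv : convop B) i f : nnmeas f ->
  conv (distribution P (walk i)) f = iter i A (B f).
Proof.
move=> mf; apply/funext => t; rewrite conv_distribution//.
rewrite (integral_prefix_sumS (@summand_indep i) t (ltnSn i))//.
have -> : conv (distribution P (summand i i)) f = B f.
  by apply: eq_conv_distribution => C mC; rewrite /summand ltnn etas_law.
have : nnmeas (B f) by exact: convop_nnmeas.
move: (B f) => f' {mf f}; have : (i <= i)%N by [].
(* the number of terms varies while their list, indexed by i, stays the same *)
move: {1 4 5}i => n; elim: n f' => [|n IH] f ni mf.
  have -> : (\int[P]_w f (t - prefix_sum (summand i) 0 w)%R = \int[P]_(w in setT) (cst (f t)) w)%E.
    by apply: eq_integral => w _; rewrite /prefix_sum /= big_ord0 subr0.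
  by rewrite integral_cst//= probability_setT mule1.
rewrite (integral_prefix_sumS (@summand_indep i) t (ltnW ni))//.
have -> : conv (distribution P (summand i n)) f = A f.
  by apply: eq_conv_distribution => C mC; rewrite /summand ni xis_law.
by rewrite IH ?iterSr//; [exact: ltnW|exact: convop_nnmeas].
Qed.

End walk.

(** * Additive semigroups of the half-line *)

Section semigroup.
Context {R : realType}.

Section dense.
Variable S : set R.
Hypothesis S0 : S 0.
Hypothesis S_ge0 : forall x, S x -> 0 <= x.
Hypothesis SD : forall x y, S x -> S y -> S (x + y).
Hypothesis S_nonlattice :
  forall d, 0 < d -> exists2 x, S x & ~ range (fun n : nat => n%:R * d) x.

Lemma semigroup_mulrn n x : S x -> S (n%:R * x).
Proof.
move=> Sx; elim: n => [|n IH]; first by rewrite mul0r.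
by rewrite -natr1 mulrDl mul1r; exact: SD.
Qed.

(** Suppose that the infimum delta of the positive differences of elements of S is
    positive, and let x be a difference smaller than 2 delta. Every c > 0 in S is the
    difference (c + c) - c. If its remainder r modulo x were not zero, r and x - r
    would be two positive differences of sum less than 2 delta. Hence S would be
    contained in the lattice of multiples of x. *)
Lemma semigroup_small_difference e : 0 < e ->
  exists a b, [/\ S a, S b, a < b & b - a < e].
Proof.
move=> e0; apply: contrapT => noab.
pose D := [set x | 0 < x /\ exists a b, [/\ S a, S b & x = b - a]].
have De x : D x -> e <= x.
  move=> [x0 [a [b [Sa Sb xE]]]]; rewrite leNgt; apply/negP => xe.
  by apply: noab; exists a, b; split => //; lra.
have SDpos c : S c -> 0 < c -> D c.
  by move=> Sc c0; split => //; exists c, (c + c); split => //; [exact: SD|lra].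
have pos d : 0 < d -> exists2 c, 0 < c & S c /\ ~ range (fun n : nat => n%:R * d) c.
  move=> d0; have [c Sc cd] := S_nonlattice d0; exists c => //.
  rewrite lt_neqAle S_ge0// andbT; apply/eqP => c0; apply: cd.
  by exists 0%N; rewrite // mul0r.
have [c0 c00 [Sc0 _]] := pos 1 ltr01.
have iD : has_inf D.
  split; first by exists c0; exact: SDpos.
  by exists e => x; exact: De.
have dinf : e <= inf D by apply: lb_le_inf => //; exact: iD.1.
have [x [x0 [a [b [Sa Sb xE]]]] x2] := inf_adherent (lt_le_trans e0 dinf) iD.
have [c cpos [Sc cx]] := pos x x0.
pose q := Num.truncn (c / x).
have /andP[qc cq] : (q%:R <= c / x < q.+1%:R) by apply: truncn_itv; rewrite divr_ge0// ltW.
rewrite ler_pdivlMr// in qc; rewrite ltr_pdivrMr// in cq.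
have Sqa := semigroup_mulrn q Sa; have Sqb := semigroup_mulrn q Sb.
have qxE : q%:R * x = q%:R * b - q%:R * a by rewrite xE; ring.
rewrite -natr1 mulrDl mul1r in cq.
have rD : D (c - q%:R * x).
  split.
    rewrite subr_gt0 lt_neqAle qc andbT; apply/eqP => cE; apply: cx.
    by exists q.
  by exists (q%:R * b), (c + q%:R * a); split => //; [exact: SD|lra].
have xrD : D (x - (c - q%:R * x)).
  split; first lra.
  exists (a + (c + q%:R * a)), (b + q%:R * b); split => //; [by do !apply: SD|exact: SD|lra].
have h1 := ge_inf iD.2 rD; have h2 := ge_inf iD.2 xrD.
lra.
Qed.

(** For a < b in S, the points n a + k (b - a) with k <= n belong to S and fill
    [n a, n b] with gaps b - a. From some n on, these intervals overlap. *)
Lemma semigroup_asymptotically_dense e : 0 < e ->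
  exists A, forall y, A <= y -> exists2 s, S s & s <= y < s + e.
Proof.
move=> e0; have [a [b [Sa Sb ab be]]] := semigroup_small_difference e0.
have a0 := S_ge0 Sa; have b0 : 0 < b by lra.
have d0 : 0 < b - a by lra.
exists (a * b / (b - a)) => y; rewrite ler_pdivrMr// => Ay.
have y0 : 0 <= y by rewrite -(pmulr_lge0 _ d0); apply: le_trans Ay; rewrite mulr_ge0// ltW.
pose n := (Num.truncn (y / b)).+1.
have /andP[ny yn] : ((Num.truncn (y / b))%:R <= y / b < n%:R).
  by apply: truncn_itv; rewrite divr_ge0// ltW.
rewrite ler_pdivlMr// in ny; rewrite ltr_pdivrMr// in yn.
have nE : (Num.truncn (y / b))%:R = n%:R - 1 :> R by rewrite /n -natr1; ring.
rewrite nE in ny.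
have na : n%:R * a <= y.
  rewrite -(ler_pM2r b0).
  have -> : n%:R * a * b = a * ((n%:R - 1) * b) + a * b by ring.
  have : a * ((n%:R - 1) * b) <= a * y by rewrite ler_wpM2l.
  lra.
pose k := Num.truncn ((y - n%:R * a) / (b - a)).
have /andP[ky yk] : (k%:R <= (y - n%:R * a) / (b - a) < k.+1%:R).
  by apply: truncn_itv; apply: divr_ge0; lra.
rewrite ler_pdivlMr// in ky; rewrite ltr_pdivrMr// in yk.
rewrite -natr1 mulrDl mul1r in yk.
have kn : (k <= n)%N.
  rewrite -(ler_nat R) -(ler_pM2r d0); apply: le_trans ky _.
  by rewrite mulrBr; lra.
exists ((n - k)%:R * a + k%:R * b).
  by apply: SD; exact: semigroup_mulrn.
have -> : (n - k)%:R * a + k%:R * b = n%:R * a + k%:R * (b - a).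
  by rewrite natrB//; ring.
by apply/andP; split; lra.
Qed.

End dense.

Lemma bounded_limsup (phi : R -> R) (m M : R) : (forall t, m <= phi t <= M) ->
  exists l, (forall e, 0 < e -> exists T, forall t, T <= t -> phi t <= l + e) /\
    (forall e T, 0 < e -> exists2 t, T <= t & l - e <= phi t).
Proof.
move=> phib.
pose E := [set a | exists T, forall t, T <= t -> phi t <= a].
have iE : has_inf E.
  split; first by exists M, 0 => t _; have /andP[] := phib t.
  exists m => a [T Ta]; apply: le_trans (Ta T (lexx _)).
  by have /andP[] := phib T.
exists (inf E); split.
  move=> e e0; have [a [T Ta] ae] := inf_adherent e0 iE.
  by exists T => t Tt; rewrite (le_trans (Ta _ Tt))// ltW.
move=> e T e0; apply: contrapT => no.
have : E (inf E - e).
  exists T => t Tt; rewrite leNgt; apply/negP => /ltW h.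
  by apply: no; exists t.
by move/(ge_inf iE.2) => ?; lra.
Qed.

End semigroup.

(** * Limit superior of almost harmonic functions *)

Section support.
Context {R : realType}.
Variable F : probability R R.
Hypothesis F_ge0 : F `]-oo, 0[%classic = 0%E.
Hypothesis F_nonlattice : nonlattice F.

Lemma probability_tail e : 0 < e ->
  exists T, forall s, T <= s -> (F `]s, +oo[%classic <= e%:E)%E.
Proof.
move=> e0.
pose X : {RV F >-> R} := HB.pack_for {mfun R >-> R} (@idfun R)
  (isMeasurableFun.Build _ _ _ _ (@idfun R) (@measurable_id _ _ setT)).
have : \forall s \near +oo, (ccdf X s < e%:E)%E.
  have /(_ [set u | (u < e%:E)%E]) := cvg_ccdfy0 X; apply.
  by apply: open_ereal_lt'; rewrite lte_fin.
move=> [T [_ TP]]; exists (T + 1) => s Ts.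
by apply/ltW/TP; lra.
Qed.

Definition support : set R :=
  [set x | forall r : R, 0 < r -> (0 < F `](x - r)%R, (x + r)%R[%classic)%E].

Lemma lattice_measurable (d : R) : measurable (range (fun n : nat => n%:R * d)).
Proof.
by apply: countable_measurable => //; exact: card_image_le.
Qed.

(** The complement of the support is covered by countably many null intervals with
    rational ends. If the support were contained in a lattice, this lattice would
    have probability one. *)
Lemma support_not_lattice d : 0 < d ->
  exists2 x, support x & ~ range (fun n : nat => n%:R * d) x.
Proof.
move=> d0; apply: contrapT => no.
set L := range (fun n : nat => n%:R * d) in no.
have mL : measurable L by exact: lattice_measurable.
have /eqP := F_nonlattice d0; apply; rewrite -/L.
pose I (k : nat) : set R := if choice.unpickle k is Some (p, q) then
  (if F `](ratr p : R), ratr q[%classic == 0%E then `](ratr p : R), ratr q[%classic else set0)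
  else set0.
have I0 : F.-negligible (\bigcup_(k in [set: nat]) I k).
  apply: negligible_bigcup => k; rewrite /I.
  case: (choice.unpickle k) => [[p q]|]; last exact: negligible_set0.
  case: eqP => [F0|_]; last exact: negligible_set0.
  by exists `](ratr p : R), ratr q[%classic; split.
have LI : (~` L `<=` \bigcup_(k in [set: nat]) I k).
  move=> x Lx; have /existsNP[r /not_implyP[r0 /negP]] : ~ support x.
    by move=> sx; apply: no; exists x.
  rewrite -leNgt measure_le0 => /eqP F0.
  have [p /andP[p1 p2]] : exists p : rat, x - r < ratr p < x.
    have [p] := rat_in_itvoo (ltac:(lra) : x - r < x).
    by rewrite in_itv/=; exists p.
  have [q /andP[q1 q2]] : exists q : rat, x < ratr q < x + r.
    have [q] := rat_in_itvoo (ltac:(lra) : x < x + r).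
    by rewrite in_itv/=; exists q.
  exists (choice.pickle (p, q)); first exact: Logic.I.
  rewrite /I choice.pickleK.
  have -> : F `](ratr p : R), ratr q[%classic == 0%E.
    rewrite -measure_le0 -F0; apply: le_measure; rewrite ?inE//.
    by apply: subset_itvW; exact: ltW.
  by rewrite /= in_itv/= p2 q1.
have CL : F (~` L) = 0%E.
  by apply: (measure_negligible (measurableC mL)); apply: negligibleS I0.
by rewrite -[L]setCK probability_setC ?CL ?sube0//; exact: measurableC.
Qed.

Section limsup_window.
Variables (phi : R -> R) (C l : R).
Hypothesis mphi : measurable_fun setT phi.
Hypothesis phi_ge0 : forall t, 0 <= phi t.
Hypothesis phi_leC : forall t, phi t <= C.
Hypothesis phi_uc : forall e : R, 0 < e ->
  exists2 r : R, 0 < r & forall x y, `|x - y| < r -> phi x <= phi y + e.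
Hypothesis phi_conv : forall e : R, 0 < e -> exists T, forall t, T <= t ->
  ((phi t)%:E <= conv F (EFin \o phi) t + e%:E)%E.
Hypothesis limsup_le : forall e : R, 0 < e ->
  exists T, forall t, T <= t -> phi t <= l + e.
Hypothesis limsup_ge : forall e T : R, 0 < e -> exists2 t, T <= t & l - e <= phi t.

(** At large times, if phi is close to l at t then it is close to l at t - s. This
    formulation with e and e' composes directly, which gives additivity in s without
    extracting subsequences. *)
Definition transfers (s : R) := forall e : R, 0 < e -> exists2 e' : R, 0 < e' &
  exists T, forall t, T <= t -> l - e' <= phi t -> l - e <= phi (t - s).

Lemma transfersD x y : transfers x -> transfers y -> transfers (x + y).
Proof.
move=> px py e e0; have [e1 e10 [T1 h1]] := py e e0.
have [e2 e20 [T2 h2]] := px e1 e10.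
exists e2 => //; exists (Num.max T2 (T1 + x)) => t; rewrite ge_max => /andP[tT2 tT1] lt.
by rewrite opprD addrA; apply: h1; [lra|exact: h2].
Qed.

(** If phi (t - x) < l - e, then by uniform continuity phi (t - y) < l - e / 2 for
    y in a neighbourhood of x, of probability p > 0. For the other y, phi (t - y) is at
    most l + o(1) outside of a tail of small probability. So the average of
    phi (t - y), which is phi t up to o(1), is at most l - p e / 2 + o(1). *)
Lemma support_transfers x : support x -> transfers x.
Proof.
move=> sx e e0.
have e20 : 0 < e / 2 by lra.
have [r r0 uc] := phi_uc e20.
have Fr := sx r r0; set B : set R := `](x - r), (x + r)[%classic in Fr.
have Ffin : F B \is a fin_num by apply: fin_num_measure; exact: measurable_itv.
pose p := fine (F B).
have FE : F B = p%:E by rewrite fineK.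
have p0 : 0 < p by rewrite -lte_fin -FE.
(* the estimate loses at most 4 * e1 and gains p * e / 2 = 8 * e1 *)
pose e1 := p * e / 16.
have e10 : 0 < e1 by rewrite divr_gt0// mulr_gt0.
have [T0 hT0] := limsup_le e10.
have C0 : 0 <= C := le_trans (phi_ge0 0) (phi_leC 0).
have K0 : 0 < C + e / 2 by lra.
have [T1 hT1] := probability_tail (divr_gt0 e10 K0).
have [T2 hT2] := phi_conv e10.
have le10 : 0 <= l + e1 by rewrite (le_trans (phi_ge0 T0))// hT0.
exists e1 => //; exists (Num.max T2 (T0 + T1)) => t; rewrite ge_max => /andP[tT2 tT1] lt.
rewrite leNgt; apply/negP => small.
pose tail : set R := `](t - T0), +oo[%classic.
have Mtail : measurable tail by exact: measurable_itv.
have MB : measurable B by exact: measurable_itv.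
have cstE (c : R) : (\int[F]_(y in setT) c%:E = c%:E)%E.
  by rewrite integral_cst//= probability_setT mule1.
have mt : measurable_fun setT (fun y : R => (phi (t - y))%:E).
  by apply/measurable_EFinP; apply: measurableT_comp => //; exact: measurable_funB.
have mB : measurable_fun setT (fun y : R => (\1_B y : R)%:E).
  by apply/measurable_EFinP; apply: measurable_indic; exact: measurable_itv.
have mtail : measurable_fun setT (fun y : R => (\1_tail y : R)%:E).
  by apply/measurable_EFinP; apply: measurable_indic; exact: measurable_itv.
have key : (\int[F]_y ((phi (t - y))%:E + (e / 2)%:E * (\1_B y : R)%:E) <=
   \int[F]_y ((l + e1)%:E + (C + e / 2)%:E * (\1_tail y : R)%:E))%E.
  apply: ge0_le_integral => //.
  - by move=> y _; rewrite -EFinM -EFinD lee_fin addr_ge0// mulr_ge0// ltW.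
  - by apply: emeasurable_funD => //; exact: measurable_funeM.
  - by apply: emeasurable_funD => //; exact: measurable_funeM.
  move=> y _; rewrite -!EFinM -!EFinD lee_fin !indicE.
  have [yt|yt] := boolP (y \in tail).
    have := phi_leC (t - y); case: (y \in B) => /=; lra.
  have {}yt : y <= t - T0.
    rewrite leNgt; apply/negP => h; move: yt; rewrite notin_setE; apply.
    by rewrite /tail/= in_itv/= andbT.
  have := hT0 (t - y); have [yB|yB] := boolP (y \in B) => /= h; last first.
    by rewrite !mulr0 !addr0; apply: h; lra.
  have /andP[y1 y2] : x - r < y < x + r by move: yB; rewrite inE /B/= in_itv.
  have : phi (t - y) <= phi (t - x) + e / 2.
    by apply: uc; rewrite ltr_norml; apply/andP; split; lra.
  lra.
move: key; rewrite ge0_integralD//; last 3 first.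
  - by move=> y _; rewrite lee_fin.
  - by move=> y _; rewrite mule_ge0// lee_fin ltW.
  - exact: measurable_funeM.
rewrite ge0_integralZl//; last by rewrite lee_fin ltW.
rewrite ge0_integralD//; last 2 first.
  - by move=> y _; rewrite mule_ge0// lee_fin ltW.
  - exact: measurable_funeM.
rewrite (ge0_integralZl _ _ mtail)//; last by rewrite lee_fin ltW.
rewrite !integral_indic// !setIT cstE.
have tl : ((C + e / 2)%:E * F tail <= e1%:E)%E.
  have := hT1 (t - T0) (ltac:(lra)); rewrite -/tail => h.
  rewrite (_ : e1 = (C + e / 2) * (e1 / (C + e / 2))); last by field; lra.
  by rewrite EFinM lee_pmul2l// lte_fin.
have := hT2 t tT2; rewrite /conv/= FE => h2 key.
have : ((phi t)%:E + (e / 2 * p)%:E <= (l + e1 + e1 + e1)%:E)%E.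
  apply: (le_trans (leeD h2 (lexx _))).
  rewrite addeAC [leRHS]EFinD; apply: leeD => //.
  rewrite EFinM; apply: (le_trans key); rewrite [leRHS]EFinD.
  by apply: leeD.
rewrite -EFinD lee_fin.
have : e / 2 * p = 8 * e1 by rewrite /e1; field.
lra.
Qed.

(** The shifts that transfer form a semigroup which contains the support, hence is
    asymptotically dense: for some constant A, every A + k dl is close to a shift that
    transfers. It remains to look at t - A for t large with phi t close to l. *)
Lemma limsup_window (e dl T : R) (K : nat) : 0 < e -> 0 <= dl ->
  exists2 t, T <= t & forall k : nat, (k < K)%N -> l - e <= phi (t - k%:R * dl).
Proof.
move=> e0 dl0; have e20 : 0 < e / 2 by lra.
have [r r0 uc] := phi_uc e20.
pose S := [set s | 0 <= s /\ transfers s].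
have suppS x : support x -> S x.
  move=> sx; split; last exact: support_transfers.
  rewrite leNgt; apply/negP => x0.
  have := sx (- x); rewrite oppr_gt0 => /(_ x0); rewrite subrr; apply/negP.
  rewrite -leNgt measure_le0 -measure_le0 -F_ge0; apply: le_measure; rewrite ?inE//.
  by apply: subset_itvr; rewrite bnd_simp.
have [A AP] : exists A, forall y, A <= y -> exists2 s, S s & s <= y < s + r.
  apply: semigroup_asymptotically_dense => //.
  - split => // e1 e10; exists e1 => //; exists 0 => t _; by rewrite subr0.
  - by move=> x [].
  - by move=> x y [x0 px] [y0 py]; split; [exact: addr_ge0|exact: transfersD].
  - move=> d d0; have [x sx xd] := support_not_lattice d0.
    by exists x => //; exact: suppS.
have [e' e'0 [T' T'P]] : exists2 e' : R, 0 < e' & exists T', forall t, T' <= t ->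
    l - e' <= phi t -> forall k : nat, (k < K)%N ->
    l - e <= phi (t - (A + k%:R * dl)).
  elim: K => [|K [e1 e10 [T1 h1]]]; first by exists 1 => //; exists 0.
  have [s [s0 /(_ (e / 2) e20)[e2 e20' [T2 h2]]] /andP[sy ys]] :=
    AP ((A + K%:R * dl)) (ltac:(by rewrite lerDl mulr_ge0)).
  exists (Num.min e1 e2); first by rewrite lt_min e10.
  exists (Num.max T1 T2) => t; rewrite ge_max => /andP[t1 t2] lt k.
  have le1 : l - e1 <= phi t by apply: le_trans lt; rewrite lerB// ge_min lexx.
  have le2 : l - e2 <= phi t by apply: le_trans lt; rewrite lerB// ge_min lexx orbT.
  rewrite ltnS leq_eqVlt => /orP[/eqP ->|]; last exact: h1.
  have : phi (t - s) <= phi (t - (A + K%:R * dl)) + e / 2.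
    by apply: uc; rewrite ltr_norml; apply/andP; split; lra.
  have := h2 t t2 le2; lra.
have [t Tt lt] := limsup_ge (Num.max T' (T + A)) e'0.
move: Tt; rewrite ge_max => /andP[T't TAt].
exists (t - A); first lra.
move=> k kK; by have := T'P t T't lt k kK; rewrite opprD addrA.
Qed.

End limsup_window.
End support.

(** * Laws on the positive half-line *)

Section elementary_functions.
Context {R : realType}.
Implicit Types x t : R.

Definition step x : \bar R := (0 <= x)%R%:R%:E.
Definition box (L : R) x : \bar R := (0 <= x < L)%R%:R%:E.

Lemma nnmeas_bool (p : R -> bool) : measurable [set x | p x] ->
  nnmeas (fun x => (p x)%:R%:E : \bar R).
Proof.
move=> mp; split; last by move=> x; rewrite lee_fin.
have -> : (fun x => (p x)%:R%:E) = EFin \o (\1_[set x | p x] : R -> R).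
  by apply/funext => x /=; rewrite indicE mem_setE.
by apply/measurable_EFinP; exact: measurable_indic.
Qed.

Lemma nnmeas_step : nnmeas step.
Proof.
apply: nnmeas_bool; rewrite (_ : [set _ | _] = `[0, +oo[%classic)//.
by apply/seteqP; split => x /=; rewrite in_itv/= andbT.
Qed.

Lemma nnmeas_box L : nnmeas (box L).
Proof.
by apply: nnmeas_bool; rewrite (_ : [set _ | _] = `[0, L[%classic).
Qed.

Lemma box_cover (a L : R) : 0 < a -> exists n, forall x,
  (box L x <= \sum_(k < n) box a (x - k%:R * a)%R)%E.
Proof.
move=> a0; exists (Num.truncn (L / a)).+1 => x.
rewrite /box sumEFin lee_fin; have [/andP[x0 xL]|_] := boolP (0 <= x < L); last first.
  by apply: sumr_ge0.
have /andP[xk kx] : (Num.truncn (x / a))%:R <= x / a < (Num.truncn (x / a)).+1%:R.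
  by apply: truncn_itv; rewrite divr_ge0// ltW.
have kn : (Num.truncn (x / a) < (Num.truncn (L / a)).+1)%N.
  rewrite ltnS; apply: le_truncn; rewrite ler_pM2r ?invr_gt0//; exact: ltW.
rewrite (bigD1 (Ordinal kn))//=.
rewrite ler_pdivlMr// in xk; rewrite ltr_pdivrMr// in kx.
rewrite -natr1 mulrDl mul1r in kx.
have -> : 0 <= x - (Num.truncn (x / a))%:R * a < a by apply/andP; split; lra.
by rewrite lerDl sumr_ge0.
Qed.

End elementary_functions.

Section probability_on_halfline.
Context {R : realType}.
Variable F : probability R R.
Hypothesis F_gt0 : F `]-oo, 0]%classic = 0%E.

Lemma null_negative : F `]-oo, 0[%classic = 0%E.
Proof.
apply/eqP; rewrite -measure_le0 -F_gt0; apply: le_measure; rewrite ?inE//.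
by apply: subset_itvl; rewrite bnd_simp.
Qed.

Lemma convop_convF : convop (conv F).
Proof. exact/conv_convop/null_negative. Qed.

Lemma conv_step t : conv F step t = F `]-oo, t]%classic.
Proof.
rewrite -(setIT `]-oo, t]%classic) -integral_indic//.
by apply: eq_integral => y _; rewrite /step indicE mem_setE in_itv/= subr_ge0.
Qed.

Lemma conv_step_le1 t : (conv F step t <= 1)%E.
Proof. by rewrite conv_step; exact: probability_le1. Qed.

Lemma conv_step_cvg e : 0 < e -> exists T, forall t, T <= t ->
  ((1 - e)%:E <= conv F step t)%E.
Proof.
move=> e0; have [T hT] := probability_tail F e0.
exists T => t Tt; rewrite conv_step.
have -> : `]-oo, t]%classic = ~` `]t, +oo[%classic by rewrite setCitvr.
rewrite probability_setC; last exact: measurable_itv.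
by rewrite EFinB; apply: leeB => //; exact: hT.
Qed.

Definition survival x : \bar R := ((0 <= x)%R%:R%:E * F `]x, +oo[%classic)%E.

(** The mass of F splits at x. In operator form this is g + A H = H, where g is the
    survival function, H the unit step and A the convolution with F. *)
Lemma survival_step x : (survival x + conv F step x = step x)%E.
Proof.
rewrite conv_step /survival /step; have [x0|x0] := leP 0 x.
  rewrite mul1e -measureU//=.
  - rewrite setUC (_ : _ `|` _ = setT) ?probability_setT//.
    by rewrite -subTset => y _ /=; rewrite !in_itv/= andbT; apply/orP; rewrite leNgt orNb.
  - by rewrite -subset0 => y /= []; rewrite !in_itv/= andbT => h /le_lt_trans/(_ h); rewrite ltxx.
rewrite mul0e add0e; apply/eqP; rewrite -measure_le0 -F_gt0; apply: le_measure; rewrite ?inE//.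
by apply: subset_itvl; rewrite bnd_simp ltW.
Qed.

Lemma nnmeas_survival : nnmeas survival.
Proof.
split; last by move=> x; rewrite mule_ge0.
have -> : survival = (fun x => step x - conv F step x)%E.
  apply/funext => x; rewrite -survival_step addeK//.
  by rewrite conv_step; exact: fin_num_measure.
apply: emeasurable_funB; first exact: nnmeas_step.1.
exact: (convop_nnmeas convop_convF nnmeas_step).1.
Qed.

Lemma tail_positive : exists2 a : R, 0 < a & (0 < F `]a, +oo[%classic)%E.
Proof.
apply: contrapT => no.
have N n : F.-negligible `](n.+1%:R^-1 : R), +oo[%classic.
  apply/negligibleP => //; apply/eqP; rewrite -measure_le0 leNgt; apply/negP => h.
  by apply: no; exists n.+1%:R^-1; rewrite // invr_gt0.
have := negligible_bigcup N.
have -> : (\bigcup_(n in [set: nat]) `](n.+1%:R^-1 : R), +oo[%classic)%classic = ~` `]-oo, 0]%classic.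
  rewrite setCitvl; apply/seteqP; split => [x [n _]/=|x/=]; rewrite !in_itv/= !andbT.
    by apply: lt_trans; rewrite invr_gt0.
  move=> x0; exists (Num.truncn x^-1) => //=; rewrite in_itv/= andbT.
  rewrite invf_plt ?posrE//.
  by have /andP[] : ((Num.truncn x^-1)%:R <= x^-1 < (Num.truncn x^-1).+1%:R)
    by apply: truncn_itv; rewrite invr_ge0 ltW.
move=> /(measure_negligible (measurableC (measurable_itv _))) F0.
have : F (~` `]-oo, 0]%classic) = 0%E by exact: F0.
rewrite probability_setC; last exact: measurable_itv.
by rewrite F_gt0 sube0 => /eqP; rewrite onee_eq0.
Qed.

(** The Laplace transform of F at 1, which is the eigenvalue of the convolution with F
    on the exponential. *)
Definition laplace : \bar R := (\int[F]_y (expR (- y))%:E)%E.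

Lemma conv_expR t : conv F (EFin \o expR) t = ((expR t)%:E * laplace)%E.
Proof.
rewrite /conv /laplace -ge0_integralZl//=.
- by apply: eq_integral => y _; rewrite expRD EFinM.
- by apply/measurable_EFinP; apply: measurableT_comp.
Qed.

(** For a > 0 with F (]a, +oo[) > 0, one has e^-y + (1 - e^-a) 1_(y > a) <= 1 for
    almost every y. *)
Lemma laplace_lt1 : (laplace < 1)%E.
Proof.
have [a a0 Fa] := tail_positive.
have e1 : expR (- a) < 1 by rewrite expR_lt1; lra.
set p := F `]a, +oo[%classic in Fa.
have pfin : p \is a fin_num by apply: fin_num_measure; exact: measurable_itv.
have Mtail : measurable (`]a, +oo[%classic : set R) by exact: measurable_itv.
have mexp : measurable_fun setT (fun y : R => (expR (- y))%:E).
  by apply/measurable_EFinP; apply: measurableT_comp => //.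
have mi : measurable_fun setT (fun y : R => (\1_(`]a, +oo[%classic : set R) y : R)%:E).
  by apply/measurable_EFinP; exact: measurable_indic.
have key : (\int[F]_y ((expR (- y))%:E + (1 - expR (- a))%:E * (\1_(`]a, +oo[%classic : set R) y : R)%:E)
    <= \int[F]_(y in setT) 1%:E)%E.
  apply: ae_ge0_le_integral => //.
  - move=> y _; rewrite -EFinM -EFinD lee_fin addr_ge0// ?expR_ge0// mulr_ge0//; lra.
  - by apply: emeasurable_funD => //; exact: measurable_funeM.
  exists `]-oo, 0]%classic; split => // y /=; rewrite in_itv/=; apply: contra_notP => /negP.
  rewrite -ltNge => y0 _; rewrite -EFinM -EFinD lee_fin indicE.
  have [|_] := boolP (y \in _); last by rewrite mulr0 addr0 ltW// expR_lt1; lra.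
  rewrite inE/= in_itv/= andbT => ay.
  have : expR (- y) <= expR (- a) by rewrite ler_expR; lra.
  rewrite mulr1; lra.
move: key; rewrite ge0_integralD//; last 2 first.
  - by move=> y _; rewrite mule_ge0// lee_fin; lra.
  - exact: measurable_funeM.
rewrite ge0_integralZl//; last by rewrite lee_fin; lra.
rewrite integral_indic// setIT -/p integral_cst//= probability_setT mule1 -/laplace => key.
have l0 : (0 <= laplace)%E by apply: integral_ge0 => y _; rewrite lee_fin expR_ge0.
have pos : (0 < (1 - expR (- a))%:E * p)%E by rewrite mule_gt0// lte_fin; lra.
have lfin : laplace \is a fin_num.
  rewrite ge0_fin_numE//; apply: le_lt_trans (ltry 1); apply: le_trans key.
  by rewrite leeDl// ltW.
by apply: lt_le_trans key; rewrite lteDl.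
Qed.

End probability_on_halfline.

(** * The renewal operator of a perturbed random walk *)

Section renewal.
Context {R : realType}.
Variables F G : probability R R.
Hypothesis F_gt0 : F `]-oo, 0]%classic = 0%E.
Hypothesis G_gt0 : G `]-oo, 0]%classic = 0%E.

(** The operator that maps f to the expectation of the sum over i of f (t - T_i), when
    T_i is a sum of i independent variables of law F and one of law G. *)
Definition renewal (f : R -> \bar R) (t : R) : \bar R :=
  (\sum_(n <oo) iter n (conv F) (conv G f) t)%E.

Local Notation A := (conv F).
Local Notation B := (conv G).
Local Notation W := renewal.
Let cA : convop A := convop_convF F_gt0.
Let cB : convop B := convop_convF G_gt0.

Lemma convop_renewal : convop W.
Proof.
apply: (@convop_nneseries _ (fun n f => iter n A (B f))) => n.
exact: (convop_comp (convop_iter n cA) cB).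
Qed.
Let cW := convop_renewal.

Let nnB f : nnmeas f -> nnmeas (B f). Proof. exact: convop_nnmeas cB _. Qed.
Let nnAn n f : nnmeas f -> nnmeas (iter n A f).
Proof. exact: convop_nnmeas (convop_iter n cA) _. Qed.

Lemma renewal_equation f t : nnmeas f -> (W f t = B f t + A (W f) t)%E.
Proof.
move=> mf; rewrite /W nneseries_recl//; last first.
  by move=> n _; exact: (nnAn n (nnB mf)).2.
congr (_ + _)%E; rewrite (convop_series cA) ; last by move=> n; exact/nnAn/nnB.
rewrite -nneseries_addn; last by move=> n; exact: (nnAn n (nnB mf)).2.
by apply: eq_eseriesr => n _; rewrite addn1.
Qed.

(** Since g = H - A H and the two convolutions commute, the terms A^n B g telescope. *)
Lemma renewal_survival_partial N t :
  (\sum_(0 <= n < N) iter n A (B (survival F)) t + iter N A (B step) t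
   = B step t)%E.
Proof.
have ms : nnmeas (@step R) := nnmeas_step.
have mo := nnmeas_survival F_gt0.
elim: N => [|N IH]; first by rewrite big_geq// add0e.
rewrite big_nat_recr//= -addeA -[RHS]IH; congr (_ + _)%E.
rewrite -[A (iter N A _)]/(iter N.+1 A (B step)) iterSr (convC _ _ ms).
rewrite -(convop_add (convop_iter N cA)); last 2 first.
  exact: nnB.
  exact: nnB (convop_nnmeas cA ms).
congr (iter N A _ _); apply/funext => x.
rewrite -(convop_add cB)//; last exact: convop_nnmeas cA _ ms.
by congr (B _ _); apply/funext => y; rewrite survival_step.
Qed.

Let mexp : nnmeas (EFin \o @expR R).
Proof. by split; [exact/measurable_EFinP|move=> x; rewrite lee_fin expR_ge0]. Qed.

Lemma laplace_in01 (K : probability R R) (K0 : K `]-oo, 0]%classic = 0%E) :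
  exists r : R, [/\ 0 <= r, r < 1 & laplace K = r%:E].
Proof.
have l1 := laplace_lt1 K0.
have l0 : (0 <= laplace K)%E by apply: integral_ge0 => y _; rewrite lee_fin expR_ge0.
have lf : laplace K \is a fin_num.
  by rewrite ge0_fin_numE// (lt_trans l1)// ltry.
exists (fine (laplace K)); rewrite fineK//; split => //.
  by rewrite fine_ge0.
by rewrite -lte_fin fineK.
Qed.

Lemma iter_conv_expR n t (b : R) : 0 <= b ->
  (iter n A (fun x => b%:E * (expR x)%:E) t = (expR t * b)%:E * laplace F ^+ n)%E.
Proof.
move=> b0; elim: n t => [|n IH] t; first by rewrite /= mule1 -EFinM mulrC.
have [r [r0 r1 rE]] := laplace_in01 F_gt0.
have E : iter n A (fun x => b%:E * (expR x)%:E)%E = (fun x => (b * r ^+ n)%:E * (EFin \o expR) x)%E.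
  apply/funext => x; rewrite IH rE -EFin_expe -!EFinM/=; congr EFin; ring.
rewrite iterS E (convop_scale cA) ?conv_expR//; last by rewrite mulr_ge0// exprn_ge0.
rewrite rE -EFin_expe -!EFinM exprS; congr EFin; ring.
Qed.

(** A geometric series. It makes W finite on the functions dominated by the
    exponential, among them the unit step. *)
Lemma renewal_expR : exists2 c : R, 0 <= c &
  forall t, (W (EFin \o expR) t = c%:E * (expR t)%:E)%E.
Proof.
have [r [r0 r1 rE]] := laplace_in01 F_gt0.
have [b [b0 b1 bE]] := laplace_in01 G_gt0.
exists (b / (1 - r)); first by rewrite divr_ge0// subr_ge0 ltW.
move=> t; rewrite /W.
have -> : B (EFin \o expR) = (fun x => b%:E * (expR x)%:E)%E.
  by apply/funext => x; rewrite conv_expR bE muleC.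
have -> : (\sum_(n <oo) iter n A (fun x => b%:E * (expR x)%:E) t =
    \sum_(n <oo) (geometric (expR t * b) r n)%:E)%E.
  by apply: eq_eseriesr => n _; rewrite iter_conv_expR// rE -EFin_expe -EFinM/=.
apply/cvg_lim => //.
rewrite (_ : (fun n => _) = EFin \o series (geometric (expR t * b) r)); last first.
  by apply/funext => n /=; rewrite sumEFin.
rewrite -EFinM (_ : b / (1 - r) * expR t = expR t * b / (1 - r)); last by field; lra.
apply: cvg_EFin; first by apply: nearW.
apply: cvg_geometric_series.
by rewrite ger0_norm.
Qed.

Lemma step_le_expR x : (@step R x <= (EFin \o expR) x)%E.
Proof.
rewrite /step lee_fin; have [x0|_] := leP 0 x; last by rewrite expR_ge0.
by rewrite -expR0 ler_expR.
Qed.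

(** The unit step is at most the exponential, which A multiplies by a constant less
    than 1. *)
Lemma iter_conv_step_small t e : 0 < e -> exists N, (iter N A (B step) t <= e%:E)%E.
Proof.
move=> e0.
have [r [r0 r1 rE]] := laplace_in01 F_gt0.
have [b [b0 b1 bE]] := laplace_in01 G_gt0.
have : (geometric (expR t * b) r n) @[n --> \oo] --> (0 : R).
  by apply: cvg_geometric; rewrite ger0_norm.
move=> /cvgr_le/(_ e e0)[N _ NP]; exists N.
have := NP N (leqnn N); rewrite /geometric/= => h.
apply: (@le_trans _ _ (iter N A (B (EFin \o expR)) t)).
  apply: (convop_le (convop_iter N cA)); [exact: nnB nnmeas_step|exact: nnB mexp|].
  move=> x; apply: (convop_le cB) => //; [exact: nnmeas_step|exact: step_le_expR].
have -> : B (EFin \o expR) = (fun x => b%:E * (expR x)%:E)%E.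
  by apply/funext => x; rewrite conv_expR bE muleC.
by rewrite iter_conv_expR// rE -EFin_expe -EFinM lee_fin.
Qed.

Lemma renewal_survival t : W (survival F) t = B step t.
Proof.
have pos n := (nnAn n (nnB (nnmeas_survival F_gt0))).2.
apply/eqP; rewrite eq_le; apply/andP; split.
  rewrite /W; apply: lime_le; first by apply: is_cvg_nneseries.
  apply: nearW => N; rewrite -(renewal_survival_partial N) leeDl//.
  exact: (nnAn N (nnB nnmeas_step)).2.
apply/lee_addgt0Pr => e e0; have [N Ne] := iter_conv_step_small t e0.
rewrite -(renewal_survival_partial N); apply: leeD => //.
exact: nneseries_lim_ge.
Qed.

Lemma renewal_survival_le1 t : (W (survival F) t <= 1)%E.
Proof. by rewrite renewal_survival; exact: conv_step_le1. Qed.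

(** If p = F (]a, +oo[) is positive, then p 1_[0,a[ is at most the survival function, whose
    image by W is at most 1. This is uniform in t. *)
Lemma renewal_box_bounded L : exists2 C : R, 0 <= C & forall t, (W (box L) t <= C%:E)%E.
Proof.
have [a a0 Fa] := tail_positive F_gt0.
have Ffin : F `]a, +oo[%classic \is a fin_num by apply: fin_num_measure; exact: measurable_itv.
set p := fine (F `]a, +oo[%classic).
have pE : F `]a, +oo[%classic = p%:E by rewrite fineK.
have p0 : 0 < p by rewrite -lte_fin -pE.
have [n cover] := box_cover L a0.
have ba t : (W (box a) t <= (p^-1)%:E)%E.
  rewrite -[X in (X <= _)%E]mul1e -(@mulVf _ p) ?gt_eqF// EFinM -muleA -[leRHS]mule1.
  rewrite lee_pmul2l ?lte_fin ?invr_gt0// -(convop_scale cW); [|exact: nnmeas_box|exact: ltW].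
  apply: le_trans (renewal_survival_le1 t); apply: (convop_le cW).
  - by apply: nnmeasZ; [exact: ltW|exact: nnmeas_box].
  - exact: nnmeas_survival.
  move=> x; rewrite /box /survival; case: (leP 0 x) => [x0|x0] /=; last by rewrite mule0 mul0e.
  rewrite mul1e; case: ltP => xa /=; last by rewrite mule0.
  by rewrite mule1 -pE; apply: le_measure; rewrite ?inE//; apply: subset_itvr; rewrite bnd_simp ltW.
exists (n%:R * p^-1); first by rewrite mulr_ge0// invr_ge0 ltW.
move=> t; apply: (@le_trans _ _ (W (fun x => \sum_(k < n) box a (x - k%:R * a)%R)%E t)).
  apply: (convop_le cW) => //; first exact: nnmeas_box.
  apply: (@nnmeas_sum _ n (fun k x => box a (x - k%:R * a))) => k.
  exact: (nnmeas_shift (f := box a) (- _) (nnmeas_box a)).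
rewrite (convop_sum (f_ := fun k x => box a (x - k%:R * a)) _ _ cW); last first.
  by move=> k; exact: (nnmeas_shift (f := box a) (- _) (nnmeas_box a)).
rewrite (_ : (n%:R / p)%:E = (\sum_(k < n) (p^-1)%:E)%E); last first.
  by rewrite sumEFin sumr_const card_ord mulr_natl.
apply: lee_sum => k _; rewrite (convop_shift cW (f := box a) (- _)); last exact: nnmeas_box.
exact: ba.
Qed.

End renewal.

(** * Tents, and the mean as a sum of tail probabilities *)

Section tent.
Context {R : realType}.
Implicit Types u a : R.

Definition ramp u : R := Num.min 1 (Num.max 0 u).

Lemma rampP u :
  (u <= 0 /\ ramp u = 0) \/ (0 <= u <= 1 /\ ramp u = u) \/ (1 <= u /\ ramp u = 1).
Proof.
rewrite /ramp; case: (leP u 0) => u0.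
  by left; split => //; rewrite min_r.
case: (leP 1 u) => u1; first by right; right.
by right; left; split => //; rewrite !ltW.
Qed.

Lemma ramp_homo u a : 0 <= a -> ramp u <= ramp (u + a) <= ramp u + a.
Proof.
move=> a0; case: (rampP u) => [[h ->]|[[/andP[h h'] ->]|[h ->]]];
  case: (rampP (u + a)) => [[k ->]|[[/andP[k k'] ->]|[k ->]]]; apply/andP; split; lra.
Qed.

(** Written with ramps so that sums of integer translates telescope. *)
Definition tent u : R := ramp u - ramp (u - 1).

Lemma tent_ge0 u : 0 <= tent u.
Proof. by have /andP[+ _] := ramp_homo (u - 1) ler01; rewrite subrK /tent subr_ge0. Qed.

Lemma tent_le1 u : tent u <= 1.
Proof.
by have /andP[_] := ramp_homo (u - 1) ler01; rewrite subrK /tent; lra.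
Qed.

Lemma tent_out u : ~~ (0 <= u < 2) -> tent u = 0.
Proof.
move=> h; have {h} : u <= 0 \/ 2 <= u.
  by move: h; case: (leP 0 u) => [u0|/ltW]; [rewrite -leNgt; right|left].
by rewrite /tent; case: (rampP u) => [[h ->]|[[/andP[h h'] ->]|[h ->]]];
  case: (rampP (u - 1)) => [[k ->]|[[/andP[k k'] ->]|[k ->]]] []; lra.
Qed.

Lemma tent_shift u a : tent (u + a) <= tent u + `|a|.
Proof.
rewrite /tent [u + a - 1]addrAC; have [a0|a0] := leP 0 a.
  rewrite ger0_norm//.
  by have /andP[h1 h2] := ramp_homo u a0; have /andP[h3 h4] := ramp_homo (u - 1) a0; lra.
rewrite ltr0_norm//; have a0' : 0 <= - a by lra.
have /andP[] := ramp_homo (u + a) a0'; have /andP[] := ramp_homo (u - 1 + a) a0'.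
by rewrite !addrK; lra.
Qed.

Lemma sum_tent n u : \sum_(k < n) tent (u - k%:R) = ramp u - ramp (u - n%:R).
Proof.
elim: n => [|n IH]; first by rewrite big_ord0 subr0 subrr.
have -> : u - n.+1%:R = u - n%:R - 1 by rewrite -natr1; lra.
by rewrite big_ord_recr/= IH /tent; lra.
Qed.

Lemma measurable_tent : measurable_fun setT tent.
Proof.
have mr : measurable_fun setT ramp.
  by apply: measurable_minr => //; apply: measurable_maxr.
by apply: measurable_funB => //; apply: measurableT_comp => //; exact: measurable_funB.
Qed.

End tent.

Section mean.
Context {R : realType}.
Variables (F : probability R R) (m dl : R).
Hypothesis mean : (\int[F]_y (Num.max 0 y)%:E = m%:E)%E.
Hypothesis dl0 : 0 < dl.

Definition tail_at (k : nat) : R := fine (F `]k%:R * dl, +oo[%classic).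

Lemma tail_atE k : F `]k%:R * dl, +oo[%classic = (tail_at k)%:E.
Proof. by rewrite fineK//; apply: fin_num_measure; exact: measurable_itv. Qed.

Lemma tail_at_ge0 k : 0 <= tail_at k. Proof. exact: fine_ge0. Qed.

Lemma tail_at_le1 k : tail_at k <= 1.
Proof. by rewrite -lee_fin -tail_atE; exact: probability_le1. Qed.

Lemma integral_tail_at k : (\int[F]_y (dl * (k%:R * dl < y)%R%:R)%:E = (dl * tail_at k)%:E)%E.
Proof.
have E : (fun y : R => (dl * (k%:R * dl < y)%R%:R)%:E) =
   (fun y => dl%:E * (\1_(`]k%:R * dl, +oo[%classic : set R) y : R)%:E)%E.
  by apply/funext => y; rewrite indicE mem_setE in_itv/= andbT.
have M : measurable (`]k%:R * dl, +oo[%classic : set R) by exact: measurable_itv.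
rewrite E ge0_integralZl//; last 2 first.
  by apply/measurable_EFinP; exact: measurable_indic.
  by rewrite lee_fin ltW.
by rewrite integral_indic// setIT EFinM -tail_atE.
Qed.

Let mlt (k : nat) : measurable_fun setT (fun y : R => (dl * (k%:R * dl < y)%R%:R)%:E).
Proof.
apply/measurable_EFinP/measurable_funM => //.
have -> : (fun y => (k%:R * dl < y)%R%:R) = (\1_(`]k%:R * dl, +oo[%classic) : R -> R).
  by apply/funext => y; rewrite indicE mem_setE in_itv/= andbT.
by apply: measurable_indic; exact: measurable_itv.
Qed.

(** For y > 0, dl times the number of k >= 0 with k dl < y is at least y. *)
Lemma mean_le_tails : (m%:E <= \sum_(k <oo) (dl * tail_at k)%:E)%E.
Proof.
rewrite -mean; under eq_eseriesr do rewrite -integral_tail_at.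
rewrite -integral_nneseries//; last first.
  by move=> n x _; rewrite lee_fin mulr_ge0// ltW.
apply: ge0_le_integral => //.
- by move=> y _; rewrite lee_fin le_max lexx.
- by apply/measurable_EFinP; apply: measurable_maxr.
- apply: ge0_emeasurable_sum => // k y _ _; rewrite lee_fin mulr_ge0// ltW//.
move=> y _; set n := (Num.truncn (Num.max 0 y / dl)).+1.
have my : 0 <= Num.max 0 y by rewrite le_max lexx.
have yn : Num.max 0 y <= n%:R * dl.
  rewrite -ler_pdivrMr//; apply: ltW.
  by have /andP[] := truncn_itv (divr_ge0 my (ltW dl0)).
apply: le_trans (nneseries_lim_ge n _); last by move=> k _ _; rewrite lee_fin mulr_ge0// ltW.
rewrite sumEFin lee_fin big_mkord.
have : Num.min (Num.max 0 y) (n%:R * dl) <= \sum_(i < n) dl * (i%:R * dl < y)%R%:R.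
  elim: (n) => [|k IH]; first by rewrite big_ord0 mul0r ge_min lexx orbT.
  rewrite big_ord_recr/=; have [yk|yk] := ltP (k%:R * dl) y.
    have y0 : 0 <= y by rewrite (le_trans _ (ltW yk))// mulr_ge0// ltW.
    move: IH; rewrite (max_r y0) (min_r (ltW yk)) mulr1 => IH.
    apply: le_trans (_ : k%:R * dl + dl <= _); last by rewrite lerD2r.
    by rewrite ge_min -natr1 mulrDl mul1r lexx orbT.
  rewrite mulr0 addr0; apply: le_trans IH.
  have k0 : 0 <= k%:R * dl by rewrite mulr_ge0// ltW.
  by rewrite le_min ge_min lexx/= ge_min ge_max k0 yk.
by rewrite min_l.
Qed.

(** For y > 0, dl times the number of k >= 1 with k dl < y is at most y. *)
Lemma tails_le_mean n : (\sum_(k < n) (dl * tail_at k.+1)%:E <= m%:E)%E.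
Proof.
rewrite -mean; under eq_bigr do rewrite -integral_tail_at.
rewrite -ge0_integral_sum//; last first.
  by move=> k y _; rewrite lee_fin mulr_ge0// ltW.
apply: ge0_le_integral => //.
- by move=> y _; apply: sume_ge0 => k _; rewrite lee_fin mulr_ge0// ltW.
- by apply: emeasurable_sum => k.
- by apply/measurable_EFinP; apply: measurable_maxr.
move=> y _; rewrite sumEFin lee_fin.
have : \sum_(i < n) dl * (i.+1%:R * dl < y)%R%:R <= Num.min (Num.max 0 y) (n%:R * dl).
  elim: n => [|k IH]; first by rewrite big_ord0 mul0r le_min le_max lexx.
  rewrite big_ord_recr/=; have [yk|yk] := ltP (k.+1%:R * dl) y.
    have y0 : 0 <= y by rewrite (le_trans _ (ltW yk))// mulr_ge0// ltW.
    rewrite (max_r y0) (min_r (ltW yk)) mulr1 -natr1 mulrDl mul1r lerD2r.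
    by apply: le_trans IH _; rewrite ge_min lexx orbT.
  rewrite mulr0 addr0; apply: (le_trans IH).
  rewrite le_min ge_min lexx/= ge_min; apply/orP; right.
  by rewrite ler_wpM2r ?ler_nat// ltW.
by move/le_trans; apply; rewrite ge_min lexx.
Qed.

Lemma tails_fin : (\sum_(k <oo) (tail_at k)%:E <= (1 + m / dl)%:E)%E.
Proof.
apply: lime_le.
  by apply: is_cvg_nneseries => k _ _; rewrite lee_fin tail_at_ge0.
apply: nearW => -[|n].
  have m0 : 0 <= m.
    rewrite -lee_fin -mean.
    by apply: integral_ge0 => y _; rewrite lee_fin le_max lexx.
  by rewrite big_geq// lee_fin addr_ge0// divr_ge0// ltW.
rewrite big_nat_recl// big_mkord EFinD; apply: leeD; first by rewrite lee_fin tail_at_le1.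
have := tails_le_mean n; rewrite !sumEFin !lee_fin => h.
by rewrite ler_pdivlMr// mulr_suml (le_trans _ h)//; apply: ler_sum => k _; rewrite mulrC.
Qed.

Lemma mean_le_partial e : 0 < e -> exists K, m - e <= \sum_(k < K) dl * tail_at k.
Proof.
move=> e0; apply: contrapT => no.
have : (\sum_(k <oo) (dl * tail_at k)%:E <= (m - e)%:E)%E.
  apply: lime_le.
    by apply: is_cvg_nneseries => k _ _; rewrite lee_fin mulr_ge0 ?tail_at_ge0// ltW.
  apply: nearW => K; rewrite big_mkord sumEFin lee_fin leNgt; apply/negP => /ltW h.
  by apply: no; exists K.
move=> /(le_trans mean_le_tails); rewrite lee_fin; lra.
Qed.

End mean.

(** * Blackwell's renewal theorem *)

Section blackwell.
Context {R : realType}.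
Variables (F G : probability R R) (m : R).
Hypothesis F_gt0 : F `]-oo, 0]%classic = 0%E.
Hypothesis G_gt0 : G `]-oo, 0]%classic = 0%E.
Hypothesis F_nonlattice : nonlattice F.
Hypothesis mean : (\int[F]_y (Num.max 0 y)%:E = m%:E)%E.

Local Notation W := (renewal F G).
Let cW : convop W := convop_renewal F_gt0 G_gt0.
Let cA : convop (conv F) := convop_convF F_gt0.
Let cB : convop (conv G) := convop_convF G_gt0.

Section mesh.
Variable dl : R.
Hypothesis dl0 : 0 < dl.

Definition bump (x : R) : \bar R := (tent (x / dl))%:E.

Lemma nnmeas_bump : nnmeas bump.
Proof.
split; last by move=> x; rewrite lee_fin tent_ge0.
apply/measurable_EFinP; apply: measurableT_comp; first exact: measurable_tent.
exact: measurable_funM.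
Qed.

Lemma bump_box x a L : 0 <= a -> dl * 2 + a <= L -> (bump x <= box L (x + a)%R)%E.
Proof.
move=> a0 aL; rewrite /bump /box lee_fin.
have [/andP[x0 x2]|/tent_out ->] := boolP (0 <= x / dl < 2); last exact: ler0n.
rewrite ler_pdivlMr// mul0r in x0; rewrite ltr_pdivrMr// in x2.
have -> : 0 <= x + a < L by apply/andP; split; lra.
exact: tent_le1.
Qed.

(** The modulus of continuity is localised by a box, so that it remains
    meaningful after applying W, whose measure is infinite. *)
Lemma bump_modulus x b : `|b| <= 1 ->
  (bump (x + b)%R <= bump x + (`|b| / dl)%:E * box (dl * 2 + 2) (x + 1)%R)%E.
Proof.
move=> b1; have := b1; rewrite ler_norml => /andP[bl bu].
have bd : 0 <= `|b| / dl by rewrite divr_ge0// ltW.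
rewrite /bump /box -EFinM -EFinD lee_fin.
have [/andP[x0 x2]|/tent_out ->] := boolP (0 <= (x + b) / dl < 2); last first.
  by rewrite addr_ge0// ?tent_ge0// mulr_ge0.
rewrite ler_pdivlMr// mul0r in x0; rewrite ltr_pdivrMr// in x2.
have -> : 0 <= x + 1 < dl * 2 + 2 by apply/andP; split; lra.
rewrite mulr1 mulrDl; apply: le_trans (tent_shift _ _) _.
by rewrite normrM (gtr0_norm (_ : 0 < dl^-1)) ?invr_gt0.
Qed.

Definition bump_mass t : R := fine (W bump t).

Lemma bump_mass_bounded : exists C, (forall t, 0 <= bump_mass t <= C) /\
  forall t, W bump t = (bump_mass t)%:E.
Proof.
have [C C0 hC] := renewal_box_bounded F_gt0 G_gt0 (dl * 2).
have bC t : (0 <= W bump t <= C%:E)%E.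
  rewrite (convop_nnmeas cW nnmeas_bump).2/= (le_trans _ (hC t))//.
  apply: (convop_le cW); [exact: nnmeas_bump|exact: nnmeas_box|].
  by move=> x; rewrite -[in leRHS](addr0 x); apply: bump_box; rewrite ?addr0.
have E t : W bump t = (bump_mass t)%:E.
  rewrite fineK// ge0_fin_numE; have /andP[h1 h2] := bC t => //.
  exact: le_lt_trans h2 (ltry _).
by exists C; split => // t; have := bC t; rewrite E !lee_fin.
Qed.


Lemma bump_mass_uc e : 0 < e ->
  exists2 r : R, 0 < r & forall x y, `|x - y| < r -> bump_mass x <= bump_mass y + e.
Proof.
move=> e0; have [_ [_ WE]] := bump_mass_bounded.
have [C C0 hC] := renewal_box_bounded F_gt0 G_gt0 (dl * 2 + 2).
have C1 : 0 < C + 1 by lra.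
exists (Num.min 1 (e * dl / (C + 1))).
  by rewrite lt_min ltr01 divr_gt0// mulr_gt0.
move=> x y; rewrite lt_min => /andP[/ltW xy1 xy2].
have bd : 0 <= `|x - y| / dl by rewrite divr_ge0// ltW.
rewrite -lee_fin EFinD -!WE.
have -> : W bump x = W (fun z => bump (z + (x - y))%R) y.
  by rewrite (convop_shift cW (f := bump)) ?subrKC//; exact: nnmeas_bump.
have nb : nnmeas (fun z => box (dl * 2 + 2) (z + 1)) by apply: nnmeas_shift; exact: nnmeas_box.
apply: (@le_trans _ _ (W (fun z => bump z + (`|x - y| / dl)%:E * box (dl * 2 + 2) (z + 1)%R)%E y)).
  apply: (convop_le cW).
  - by apply: nnmeas_shift; exact: nnmeas_bump.
  - by apply: nnmeasD; [exact: nnmeas_bump|exact: nnmeasZ].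
  - by move=> z; exact: bump_modulus.
rewrite (convop_add cW) ?(convop_scale cW)//; [|exact: nnmeas_bump|exact: nnmeasZ].
apply: leeD => //; rewrite (convop_shift cW (f := box _)); last exact: nnmeas_box.
apply: (@le_trans _ _ ((`|x - y| / dl)%:E * C%:E)%E).
  by apply: lee_wpmul2l; rewrite ?lee_fin.
rewrite -EFinM lee_fin.
rewrite ltr_pdivlMr// in xy2.
rewrite mulrAC ler_pdivrMr//; apply: le_trans (ltW xy2).
by rewrite ler_wpM2l//; lra.
Qed.

Lemma conv_bump_small e : 0 < e ->
  exists T, forall t, T <= t -> (conv G bump t <= e%:E)%E.
Proof.
move=> e0; have [T hT] := probability_tail G e0.
exists (T + dl * 2 + 1) => t Tt.
have M : measurable (`](t - dl * 2 - 1), +oo[%classic : set R) by exact: measurable_itv.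
apply: (@le_trans _ _ (G `](t - dl * 2 - 1), +oo[%classic)); last by apply: hT; lra.
rewrite -(setIT `](t - dl * 2 - 1), +oo[%classic) -integral_indic// /conv.
apply: ge0_le_integral => //.
- by move=> y _; rewrite lee_fin tent_ge0.
- exact: (nnmeas_reflect t nnmeas_bump).1.
- by apply/measurable_EFinP; exact: measurable_indic.
move=> y _; rewrite indicE mem_setE in_itv/= andbT.
have := @bump_box (t - y) 0 (dl * 2) (lexx _); rewrite !addr0 => /(_ (lexx _)) /le_trans; apply.
rewrite /box lee_fin; case: (leP 0 (t - y)) => h /=; last exact: ler0n.
case: ltP => h2 /=; last exact: ler0n.
by rewrite (_ : _ < y)//; lra.
Qed.

Lemma bump_mass_conv_le t : (conv F (EFin \o bump_mass) t <= (bump_mass t)%:E)%E.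
Proof.
have [_ [_ WE]] := bump_mass_bounded.
have -> : EFin \o bump_mass = W bump by apply/funext => x; rewrite WE.
rewrite -WE (renewal_equation F_gt0 G_gt0 _ nnmeas_bump) leeDr//.
exact: (convop_nnmeas cB nnmeas_bump).2.
Qed.

(** The renewal equation Z = B z + A Z, in which B z vanishes at infinity. *)
Lemma bump_mass_conv_ge e : 0 < e -> exists T, forall t, T <= t ->
  ((bump_mass t)%:E <= conv F (EFin \o bump_mass) t + e%:E)%E.
Proof.
move=> e0; have [T hT] := conv_bump_small e0; exists T => t Tt.
have [_ [_ WE]] := bump_mass_bounded.
have -> : EFin \o bump_mass = W bump by apply/funext => x; rewrite WE.
rewrite -WE (renewal_equation F_gt0 G_gt0 _ nnmeas_bump) addeC leeD2l//.
exact: hT.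
Qed.

Lemma measurable_bump_mass : measurable_fun setT bump_mass.
Proof.
by apply: measurableT_comp; [exact: fine_measurable|exact: (convop_nnmeas cW nnmeas_bump).1].
Qed.

Local Notation q := (tail_at F dl).

Lemma shifted_bump k x : bump (x - k%:R * dl) = (tent (x / dl - k%:R))%:E.
Proof. by rewrite /bump mulrBl mulfK// gt_eqF. Qed.

Lemma nnmeas_shifted_bump k : nnmeas (fun x => bump (x - k%:R * dl)).
Proof. exact: (nnmeas_shift (f := bump) (- _) nnmeas_bump). Qed.

Lemma sum_bump K x :
  (\sum_(k < K) bump (x - k%:R * dl)%R = (ramp (x / dl) - ramp (x / dl - K%:R))%:E)%E.
Proof. by rewrite -sum_tent -sumEFin; apply: eq_bigr => k _; rewrite shifted_bump. Qed.

(** The k-th tent is supported by x < (k + 2) dl, where the survival function is at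
    least its value at (k + 2) dl, and the tents have a sum of at most 1. *)
Lemma survival_ge_bumps K x :
  (\sum_(k < K) (q k.+2)%:E * bump (x - k%:R * dl)%R <= survival F x)%E.
Proof.
rewrite /survival; have [x0|x0] := leP 0 x; last first.
  rewrite mul0e big1// => k _; rewrite shifted_bump tent_out ?mule0//.
  rewrite negb_and -ltNge; apply/orP; left.
  have : x / dl < 0 by rewrite pmulr_llt0// invr_gt0.
  have : 0 <= k%:R :> R by [].
  lra.
rewrite mul1e.
have xfin : F `]x, +oo[%classic \is a fin_num by apply: fin_num_measure; exact: measurable_itv.
apply: (@le_trans _ _ (\sum_(k < K) F `]x, +oo[%classic * bump (x - k%:R * dl)%R)%E).
  apply: lee_sum => k _; rewrite shifted_bump.
  have [/andP[h1 h2]|/tent_out ->] := boolP (0 <= x / dl - k%:R < 2); last by rewrite !mule0.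
  apply: lee_wpmul2r; first by rewrite lee_fin tent_ge0.
  rewrite -tail_atE; apply: le_measure; rewrite ?inE//; apply: subset_itvr; rewrite bnd_simp.
  rewrite -ler_pdivrMr// -addn2 natrD; lra.
rewrite -ge0_sume_distrr; last by move=> k _; rewrite lee_fin tent_ge0.
rewrite sum_bump -[leRHS]mule1; apply: lee_wpmul2l => //; rewrite lee_fin.
by case: (rampP (x / dl)) => [[h ->]|[[/andP[h h'] ->]|[h ->]]];
  case: (rampP (x / dl - K%:R)) => [[k ->]|[[/andP[k k'] ->]|[k ->]]]; lra.
Qed.

(** The k-th tent is supported by x >= k dl, where the survival function is at most its
    value at k dl. The tent that starts at - dl completes the others to a
    partition of unity of [0, +oo[. *)
Lemma survival_le_bumps x :
  (survival F x <= bump (x + dl)%R + \sum_(k <oo) (q k)%:E * bump (x - k%:R * dl)%R)%E.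
Proof.
have pos k : (0 <= (q k)%:E * bump (x - k%:R * dl)%R)%E.
  by rewrite mule_ge0// lee_fin ?tail_at_ge0 ?tent_ge0.
rewrite /survival; have [x0|x0] := leP 0 x; last first.
  by rewrite mul0e adde_ge0//; [rewrite lee_fin tent_ge0|apply: nneseries_ge0].
rewrite mul1e; set p := F `]x, +oo[%classic.
have p1 : (p <= 1)%E by apply: probability_le1; exact: measurable_itv.
have pfin : p \is a fin_num by apply: fin_num_measure; exact: measurable_itv.
have u0 : 0 <= x / dl by rewrite divr_ge0// ltW.
pose n := (Num.truncn (x / dl)).+1.
have /andP[_ xn] : ((Num.truncn (x / dl))%:R <= x / dl < n%:R) by exact: truncn_itv.
apply: (@le_trans _ _ (bump (x + dl) + \sum_(k < n) (q k)%:E * bump (x - k%:R * dl)%R)%E); last first.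
  by rewrite leeD2l// -(big_mkord xpredT (fun k => (q k)%:E * bump (x - k%:R * dl)%R)%E); apply: nneseries_lim_ge.
apply: (@le_trans _ _ (p * bump (x + dl) + \sum_(k < n) p * bump (x - k%:R * dl)%R)%E).
  rewrite -ge0_sume_distrr; last by move=> k _; rewrite lee_fin tent_ge0.
  rewrite -ge0_muleDr; [|by rewrite lee_fin tent_ge0|by apply: sume_ge0 => k _; rewrite lee_fin tent_ge0].
  rewrite sum_bump /bump mulrDl mulfV ?gt_eqF// /tent addrK -EFinD.
  rewrite (_ : _ - _ + (_ - _) = 1) ?mule1//.
  by case: (rampP (x / dl)) => [[h ->]|[[/andP[h h'] ->]|[h ->]]];
    case: (rampP (x / dl - n%:R)) => [[k ->]|[[/andP[k k'] ->]|[k ->]]];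
    case: (rampP (x / dl + 1)) => [[l ->]|[[/andP[l l'] ->]|[l ->]]]; lra.
apply: leeD.
  by rewrite -[leRHS]mul1e; apply: lee_wpmul2r => //; rewrite lee_fin tent_ge0.
apply: lee_sum => k _; rewrite shifted_bump.
have [/andP[h1 h2]|/tent_out ->] := boolP (0 <= x / dl - k%:R < 2); last by rewrite !mule0.
apply: lee_wpmul2r; first by rewrite lee_fin tent_ge0.
rewrite -tail_atE; apply: le_measure; rewrite ?inE//; apply: subset_itvr; rewrite bnd_simp.
by rewrite -ler_pdivlMr//; lra.
Qed.

Lemma renewal_bumps_le K t : \sum_(k < K) q k.+2 * bump_mass (t - k%:R * dl) <= 1.
Proof.
have [_ [_ WE]] := bump_mass_bounded.
have nb k : nnmeas (fun x => (q k.+2)%:E * bump (x - k%:R * dl))%E.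
  by apply: nnmeasZ; [exact: tail_at_ge0|exact: nnmeas_shifted_bump].
rewrite -lee_fin; apply: le_trans (renewal_survival_le1 F_gt0 G_gt0 t).
apply: (@le_trans _ _ (W (fun x => \sum_(k < K) (q k.+2)%:E * bump (x - k%:R * dl)%R)%E t)); last first.
  apply: (convop_le cW) => [||x]; [|exact: nnmeas_survival|exact: survival_ge_bumps].
  exact: (@nnmeas_sum _ _ (fun k x => (q k.+2)%:E * bump (x - k%:R * dl))%E).
rewrite (@convop_sum _ _ K (fun k x => (q k.+2)%:E * bump (x - k%:R * dl))%E t cW nb).
rewrite -sumEFin; apply: lee_sum => k _.
rewrite (convop_scale cW) ?tail_at_ge0//; last exact: nnmeas_shifted_bump.
rewrite (convop_shift cW (f := bump) (- _)); last exact: nnmeas_bump.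
by rewrite WE EFinM.
Qed.

Lemma renewal_bumps_ge t : (conv G step t <=
  (bump_mass (t + dl))%:E + \sum_(k <oo) (q k * bump_mass (t - k%:R * dl))%:E)%E.
Proof.
have [_ [_ WE]] := bump_mass_bounded.
have nb k : nnmeas (fun x => (q k)%:E * bump (x - k%:R * dl))%E.
  by apply: nnmeasZ; [exact: tail_at_ge0|exact: nnmeas_shifted_bump].
have nd : nnmeas (fun x => bump (x + dl)) by apply: nnmeas_shift; exact: nnmeas_bump.
have ns := nnmeas_series nb.
rewrite -(renewal_survival F_gt0 G_gt0).
apply: (le_trans (convop_le cW t (nnmeas_survival F_gt0) (nnmeasD nd ns) survival_le_bumps)).
rewrite (convop_add cW)// (convop_shift cW (f := bump)); last exact: nnmeas_bump.
rewrite WE leeD2l// (convop_series cW)//.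
apply: lee_nneseries => k _; first by move=> _; exact: (convop_nnmeas cW (nb k)).2.
rewrite (convop_scale cW) ?tail_at_ge0//; last exact: nnmeas_shifted_bump.
rewrite (convop_shift cW (f := bump) (- _)); last exact: nnmeas_bump.
by rewrite WE EFinM.
Qed.


(** On a window where Z is at least hi - e, the inequality W g <= 1 bounds
    (hi - e) times the sum of the tails from k = 2 on, and dl times this sum is at
    least m - 2 dl in the limit of long windows. *)
Lemma bump_mass_hi : exists2 hi, hi * (m - dl * 2) <= dl &
  forall e, 0 < e -> exists T, forall t, T <= t -> bump_mass t <= hi + e.
Proof.
have [C [bC WE]] := bump_mass_bounded.
have z0 t : 0 <= bump_mass t by have /andP[] := bC t.
have zC t : bump_mass t <= C by have /andP[] := bC t.
have [hi [hiP hiF]] := bounded_limsup bC.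
have window := limsup_window (null_negative F_gt0) F_nonlattice measurable_bump_mass z0 zC
  bump_mass_uc bump_mass_conv_ge hiP hiF.
have hi0 : 0 <= hi.
  apply/ler_addgt0Pr => e e0; have [T hT] := hiP e e0.
  exact: le_trans (z0 T) (hT T (lexx _)).
exists hi => //.
have S1 K : hi * \sum_(k < K) q k.+2 <= 1.
  apply/ler_addgt0Pr => e e0.
  have K1 : 0 < K%:R + 1 :> R by rewrite ltr_wpDl.
  have [t _ tP] := window (e / (K%:R + 1)) dl 0 K (divr_gt0 e0 K1) (ltW dl0).
  have := renewal_bumps_le K t.
  have : \sum_(k < K) q k.+2 * (hi - e / (K%:R + 1)) <= \sum_(k < K) q k.+2 * bump_mass (t - k%:R * dl).
    by apply: ler_sum => k _; rewrite ler_wpM2l ?tail_at_ge0// tP.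
  rewrite -mulr_suml mulrBr [_ * hi]mulrC.
  have : (\sum_(k < K) q k.+2) * (e / (K%:R + 1)) <= e.
    rewrite mulrA ler_pdivrMr// mulrC; apply: ler_wpM2l; first exact: ltW.
    apply: (@le_trans _ _ (\sum_(k < K) 1)); first by apply: ler_sum => k _; exact: tail_at_le1.
    by rewrite sumr_const card_ord lerDl.
  lra.
apply/ler_addgt0Pr => e e0.
have hi1 : 0 < hi + 1 by lra.
have [K KP] := mean_le_partial mean dl0 (divr_gt0 e0 hi1).
have h1 : m - e / (hi + 1) - dl * 2 <= dl * \sum_(k < K) q k.+2.
  have : \sum_(k < K) dl * q k <= dl * (1 + 1 + \sum_(k < K) q k.+2).
    rewrite -mulr_sumr ler_wpM2l//; first exact: ltW.
    apply: (@le_trans _ _ (\sum_(k < K.+2) q k)).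
      by rewrite !big_ord_recr/= -addrA lerDl addr_ge0// tail_at_ge0.
    rewrite !big_ord_recl/= addrA; apply: lerD; last exact: lexx.
    by apply: lerD; exact: tail_at_le1.
  lra.
have h2 : hi * (m - e / (hi + 1) - dl * 2) <= dl.
  apply: le_trans (ler_wpM2l hi0 h1) _.
  by rewrite mulrCA -[leRHS]mulr1 ler_wpM2l// ltW.
have h3 : hi * (e / (hi + 1)) <= e.
  rewrite mulrA ler_pdivrMr//; lra.
lra.
Qed.

(** The window is obtained for C - Z, where C bounds Z. On it Z is at most lo + e, and W g
    tends to 1. Outside of the window Z is only bounded by C, which is enough because
    the sum of the tails converges, the mean being finite. *)
Lemma bump_mass_lo : exists2 lo, dl <= lo * (m + dl * 2) &
  forall e, 0 < e -> exists T, forall t, T <= t -> lo - e <= bump_mass t.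
Proof.
have [C [bC WE]] := bump_mass_bounded.
have z0 t : 0 <= bump_mass t by have /andP[] := bC t.
have zC t : bump_mass t <= C by have /andP[] := bC t.
(* nonnegative, as required by the window lemma *)
pose phi t := C - bump_mass t.
have phi0 t : 0 <= phi t by rewrite subr_ge0.
have phiC t : phi t <= C by rewrite gerBl.
have mphi : measurable_fun setT phi.
  by apply: measurable_funB => //; exact: measurable_bump_mass.
have phi_uc e : 0 < e ->
    exists2 r : R, 0 < r & forall x y, `|x - y| < r -> phi x <= phi y + e.
  move=> /bump_mass_uc[r r0 rP]; exists r => // x y; rewrite distrC => /rP.
  by rewrite /phi; lra.
have phi_conv e : 0 < e -> exists T, forall t, T <= t ->
    ((phi t)%:E <= conv F (EFin \o phi) t + e%:E)%E.
  move=> e0; exists 0 => t _; apply: le_trans (_ : conv F (EFin \o phi) t <= _)%E; last first.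
    by rewrite leeDl// lee_fin ltW.
  have nphi : nnmeas (EFin \o phi) by split => [|x]; [exact/measurable_EFinP|rewrite lee_fin].
  have nz : nnmeas (EFin \o bump_mass).
    by split => [|x]; [apply/measurable_EFinP; exact: measurable_bump_mass|rewrite lee_fin].
  rewrite EFinB leeBlDr//.
  apply: (@le_trans _ _ (conv F (EFin \o phi) t + conv F (EFin \o bump_mass) t)%E); last first.
    by rewrite leeD2l// bump_mass_conv_le.
  rewrite -(convop_add cA)//.
  have -> : (fun x => (EFin \o phi) x + (EFin \o bump_mass) x)%E = cst C%:E.
    by apply/funext => x; rewrite /= -EFinD /phi subrK.
  by rewrite /conv integral_cst//= probability_setT mule1.
have [l [lP lF]] := bounded_limsup (fun t => introT andP (conj (phi0 t) (phiC t))).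
have window := limsup_window (null_negative F_gt0) F_nonlattice mphi phi0 phiC
  phi_uc phi_conv lP lF.
have lo0 : 0 <= C - l.
  apply/ler_addgt0Pr => e e0; have [t _] := lF e 0 e0.
  by have := z0 t; rewrite /phi; lra.
exists (C - l); last first.
  by move=> e /lP[T hT]; exists T => t /hT; rewrite /phi; lra.
have C0 : 0 <= C := le_trans (z0 0) (zC 0).
have m0 : 0 <= m.
  rewrite -lee_fin -mean; apply: integral_ge0 => y _; rewrite lee_fin.
  by rewrite le_max lexx.
have md0 : 0 <= m / dl by rewrite divr_ge0// ltW.
suff key : 1 <= (C - l) * (2 + m / dl).
  have := ler_wpM2r (ltW dl0) key; rewrite mul1r -mulrA.
  by rewrite (_ : (2 + m / dl) * dl = m + dl * 2)//; field; rewrite gt_eqF.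
apply/ler_addgt0Pr => e e0.
(* the sum of the coefficients of e1 in the final estimate *)
pose M := 2 + m / dl + 1 + C; have M0 : 0 < M by rewrite /M; lra.
pose e1 := e / M; have e10 : 0 < e1 by rewrite divr_gt0.
have q0 k : 0 <= q k by exact: tail_at_ge0.
have qfin := tails_fin mean dl0.
have [K KP] : exists K, (\sum_(K <= k <oo) (q k)%:E <= e1%:E)%E.
  have /(_ [set u | (u < e1%:E)%E]) : (\sum_(N <= k <oo) (q k)%:E)%E @[N --> \oo] --> 0%E.
    apply: nneseries_tail_cvg; first exact: le_lt_trans qfin (ltry _).
    by move=> k _; rewrite lee_fin.
  have /[swap]/[apply] : nbhs (0%E : \bar R) [set u | (u < e1%:E)%E].
    by apply: open_ereal_lt'; rewrite lte_fin.
  by move=> [N _ NP]; exists N; apply/ltW/NP => /=.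
have [T hT] := conv_step_cvg G e10.
(* the window has K + 1 points, the first one being for the tent that starts at - dl *)
have [t Tt tP] := window e1 dl (T + dl) K.+1 e10 (ltW dl0).
have small k : (k < K.+1)%N -> bump_mass (t - k%:R * dl) <= C - l + e1.
  by move=> /tP; rewrite /phi; lra.
have := renewal_bumps_ge (t - dl); rewrite subrK.
have := hT (t - dl) (ltac:(lra)) => /le_trans h /h{h}.
rewrite (@nneseries_split _ (fun k => (q k * bump_mass (t - dl - k%:R * dl))%:E) 0 K); last first.
  by move=> k _; rewrite lee_fin mulr_ge0.
rewrite add0n => h.
have p1 : (\sum_(0 <= k < K) (q k * bump_mass (t - dl - k%:R * dl))%:E <= ((1 + m / dl) * (C - l + e1))%:E)%E.
  apply: (@le_trans _ _ (\sum_(0 <= k < K) (q k * (C - l + e1))%:E)%E).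
    rewrite !big_mkord; apply: lee_sum => k _; rewrite lee_fin ler_wpM2l//.
    have -> : t - dl - k%:R * dl = t - k.+1%:R * dl by rewrite -natr1; ring.
    exact: (small k.+1 (ltn_ord k)).
  rewrite big_mkord sumEFin lee_fin -mulr_suml ler_wpM2r//; first lra.
  rewrite -lee_fin -sumEFin; apply: le_trans qfin.
  rewrite -(big_mkord xpredT (fun k => (q k)%:E)); apply: nneseries_lim_ge => k _ _.
  by rewrite lee_fin.
have p2 : (\sum_(K <= k <oo) (q k * bump_mass (t - dl - k%:R * dl))%:E <= (C * e1)%:E)%E.
  apply: (@le_trans _ _ (\sum_(K <= k <oo) (C%:E * (q k)%:E))%E).
    apply: lee_nneseries => k _; first by move=> _; rewrite lee_fin mulr_ge0.
    by rewrite -EFinM lee_fin mulrC ler_wpM2r.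
  rewrite nneseriesZl; last by move=> k _; rewrite lee_fin.
  by rewrite EFinM; apply: lee_wpmul2l => //; rewrite lee_fin.
have := le_trans h (leeD (lexx _) (leeD p1 p2)); rewrite -!EFinD lee_fin => h'.
have := small 0%N (ltn0Sn _); rewrite mul0r subr0 => h0.
have eE : e = e1 * M by rewrite /e1 divfK// gt_eqF.
by rewrite eE /M; lra.
Qed.

End mesh.

Lemma mean_gt0 : 0 < m.
Proof.
have [a a0 Fa] := tail_positive F_gt0.
have := tails_le_mean mean a0 1; rewrite big_ord1 lee_fin; apply: lt_le_trans.
by rewrite mulr_gt0// -lte_fin -tail_atE mul1r.
Qed.

Lemma fine_mesh (h B : R) : 0 < h -> exists2 n, (0 < n)%N & h / n%:R * B <= 1.
Proof.
move=> h0; exists (Num.truncn (h * `|B|)).+1 => //.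
rewrite mulrAC ler_pdivrMr// mul1r.
have /andP[_ /ltW] : ((Num.truncn (h * `|B|))%:R <= h * `|B| < (Num.truncn (h * `|B|)).+1%:R).
  by apply: truncn_itv; rewrite mulr_ge0// ltW.
by apply: le_trans; rewrite ler_wpM2l ?ler_norm// ltW.
Qed.

Section box_bumps.
Variables (h dl : R) (n : nat).
Hypothesis dl0 : 0 < dl.
Hypothesis hE : h = n%:R * dl.

(** An interval of n meshes is covered by n + 1 tents, and contains n - 1 tents
    ([bumps_le_box]). *)
Lemma box_le_bumps x : (box h x <= \sum_(k < n.+1) bump dl (x + dl - k%:R * dl)%R)%E.
Proof.
rewrite (sum_bump dl0) /box lee_fin mulrDl mulfV ?gt_eqF//.
have [/andP[x0 xh]|_] := boolP (0 <= x < h); last first.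
  have /andP[+ _] := ramp_homo (x / dl + 1 - n.+1%:R) (ler0n R n.+1).
  by rewrite subrK subr_ge0.
rewrite hE -ltr_pdivrMr// in xh.
have u0 : 0 <= x / dl by rewrite divr_ge0// ltW.
rewrite -natr1.
by case: (rampP (x / dl + 1)) => [[k ->]|[[/andP[k k'] ->]|[k ->]]];
  case: (rampP (x / dl + 1 - (n%:R + 1))) => [[l ->]|[[/andP[l l'] ->]|[l ->]]] /=; lra.
Qed.

Lemma bumps_le_box x : (\sum_(k < n.-1) bump dl (x - k%:R * dl)%R <= box h x)%E.
Proof.
rewrite (sum_bump dl0) /box lee_fin hE -ltr_pdivrMr// -(pmulr_lge0 x (_ : 0 < dl^-1)) ?invr_gt0//.
move: (x / dl) => u; case: (n) => [|k] /=; first by rewrite subr0 subrr.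
have k0 : 0 <= k%:R :> R by [].
rewrite -natr1; case: (leP 0 u) => u0; first case: (ltP u (k%:R + 1)) => uk;
  (case: (rampP u) => [[l ->]|[[/andP[l l'] ->]|[l ->]]];
  case: (rampP (u - k%:R)) => [[j ->]|[[/andP[j j'] ->]|[j ->]]]) => /=; lra.
Qed.

End box_bumps.


Lemma renewal_sum_bumps dl n (s t : R) : 0 < dl ->
  (W (fun x => \sum_(k < n) bump dl (x + s - k%:R * dl)%R) t
   = (\sum_(k < n) bump_mass dl (t + s - k%:R * dl)%R)%:E)%E.
Proof.
move=> dl0; have [_ [_ WE]] := bump_mass_bounded dl0.
have E k x : bump dl (x + s - k%:R * dl) = bump dl (x + (s - k%:R * dl)) by rewrite addrA.
have nb k : nnmeas (fun x => bump dl (x + s - k%:R * dl)).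
  rewrite (_ : (fun _ => _) = (fun x => bump dl (x + (s - k%:R * dl)))); last exact/funext/E.
  by apply: nnmeas_shift; exact: nnmeas_bump.
rewrite (@convop_sum _ _ n (fun k x => bump dl (x + s - k%:R * dl)) t cW nb) -sumEFin.
apply: eq_bigr => k _; rewrite (_ : (fun _ => _) = (fun x => bump dl (x + (s - k%:R * dl)))); last exact/funext/E.
by rewrite (convop_shift cW (f := bump dl))// ?WE ?addrA//; exact: nnmeas_bump.
Qed.

(** The box of length h = n dl is compared with n - 1 and with n + 1 tents, whose images by
    W are asymptotically between dl / (m + 2 dl) and dl / (m - 2 dl). *)
Theorem blackwell (h : R) : 0 < h -> forall e, 0 < e -> exists T, forall t, T <= t ->
  ((h / m - e)%:E <= W (box h) t <= (h / m + e)%:E)%E.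
Proof.
move=> h0 e e0; have m0 := mean_gt0.
have em2 : 0 < e * m ^+ 2 by rewrite mulr_gt0// exprn_gt0.
(* the mesh satisfies 4 dl <= m and 2 dl (m + 2 h + e m) <= e m^2 *)
have [n n0 hn] := fine_mesh (4 / m + 2 * (m + 2 * h + e * m) / (e * m ^+ 2)) h0.
have nR : 0 < n%:R :> R by rewrite ltr0n.
pose dl := h / n%:R; have dl0 : 0 < dl by rewrite divr_gt0.
have hE : h = n%:R * dl by rewrite /dl mulrC divfK// gt_eqF.
rewrite -/dl mulrDr !mulrA in hn.
have c1 : 0 <= m + 2 * h + e * m by rewrite !addr_ge0// ?mulr_ge0// ltW.
have p1 : 0 <= dl * 4 / m by rewrite divr_ge0// ?mulr_ge0// ltW.
have p2 : 0 <= dl * 2 * (m + 2 * h + e * m) / (e * m ^+ 2).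
  by rewrite divr_ge0// ?(ltW em2)// mulr_ge0// mulr_ge0// ltW.
have d4 : dl * 4 <= m.
  have : dl * 4 / m <= 1 by lra.
  by rewrite ler_pdivrMr// mul1r.
have d2 : dl * 2 * (m + 2 * h + e * m) <= e * m ^+ 2.
  have : dl * 2 * (m + 2 * h + e * m) / (e * m ^+ 2) <= 1 by lra.
  by rewrite ler_pdivrMr// mul1r.
have dh0 : 0 <= dl * h by rewrite mulr_ge0// ltW.
have dem0 : 0 <= dl * (e * m) by rewrite mulr_ge0// ?mulr_ge0// ltW.
have dm0 : 0 <= dl * m by rewrite mulr_ge0// ltW.
have [hi hiM hiP] := bump_mass_hi dl0.
have [lo loM loP] := bump_mass_lo dl0.
have n10 : 0 < n.+1%:R :> R by rewrite ltr0n.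
have e'0 : 0 < e / 2 / n.+1%:R by rewrite !divr_gt0.
have nb k (s : R) : nnmeas (fun x => bump dl (x + s - k%:R * dl)).
  rewrite (_ : (fun _ => _) = (fun x => bump dl (x + (s - k%:R * dl)))).
    by apply: nnmeas_shift; exact: nnmeas_bump.
  by apply/funext => x; rewrite addrA.
have [T1 hT1] := hiP _ e'0; have [T2 hT2] := loP _ e'0.
have kh k : (k <= n)%N -> k%:R * dl <= h.
  by move=> kn; rewrite hE ler_wpM2r ?ler_nat// ltW.
exists (Num.max (T1 + h) (T2 + h)) => t; rewrite ge_max => /andP[t1 t2].
apply/andP; split; last first.
  apply: le_trans (_ : W (fun x => \sum_(k < n.+1) bump dl (x + dl - k%:R * dl)%R) t <= _)%E.
    apply: (convop_le cW); [exact: nnmeas_box| |exact: box_le_bumps].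
    exact: (@nnmeas_sum _ _ (fun k x => bump dl (x + dl - k%:R * dl)) (fun k => nb k dl)).
  rewrite renewal_sum_bumps// lee_fin.
  apply: (@le_trans _ _ (\sum_(k < n.+1) (hi + e / 2 / n.+1%:R))).
    apply: ler_sum => k _; apply: hT1; have := kh k (leq_ord k); lra.
  rewrite sumr_const card_ord -[leLHS]mulr_natl mulrDr.
  rewrite [n.+1%:R * (_ / _)]mulrC divfK ?gt_eqF//.
  suff : n.+1%:R * hi <= h / m + e / 2 by lra.
  have md : 0 < m - dl * 2 by lra.
  rewrite -(ler_pM2r md); apply: (@le_trans _ _ (h + dl)).
    by rewrite -mulrA; apply: le_trans (ler_wpM2l (ltW n10) hiM) _; rewrite -natr1 mulrDl mul1r -hE.
  rewrite -(ler_pM2r m0).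
  have -> : (h / m + e / 2) * (m - dl * 2) * m = h * m + e * m ^+ 2 / 2 - dl * h * 2 - dl * (e * m).
    by field; rewrite gt_eqF.
  lra.
apply: le_trans (_ : _ <= W (fun x => \sum_(k < n.-1) bump dl (x + 0 - k%:R * dl)%R) t)%E _; last first.
  apply: (convop_le cW); [|exact: nnmeas_box|].
    exact: (@nnmeas_sum _ _ (fun k x => bump dl (x + 0 - k%:R * dl)) (fun k => nb k 0)).
  by move=> x; rewrite addr0; exact: bumps_le_box.
rewrite renewal_sum_bumps// lee_fin.
(* the same error is used for both bounds, whence n + 1 instead of n - 1 *)
apply: (@le_trans _ _ (\sum_(k < n.-1) (lo - e / 2 / n.+1%:R))); last first.
  apply: ler_sum => k _; apply: hT2.
  have := kh k (leq_trans (ltnW (ltn_ord k)) (leq_pred n)); lra.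
rewrite sumr_const card_ord -[leRHS]mulr_natl mulrBr.
have h1 : n.-1%:R * (e / 2 / n.+1%:R) <= e / 2.
  rewrite mulrCA ler_piMr//; first lra.
  by rewrite ler_pdivrMr// mul1r ler_nat (leq_trans (leq_pred n)).
suff h2 : h / m - e / 2 <= n.-1%:R * lo.
  have -> : h / m - e = h / m - e / 2 - e / 2 by lra.
  exact: lerB.
have md : 0 < m + dl * 2 by lra.
rewrite -(ler_pM2r md); apply: (@le_trans _ _ (h - dl)); last first.
  rewrite -mulrA; apply: le_trans (ler_wpM2l (ler0n R n.-1) loM).
  have : n%:R = n.-1%:R + 1 :> R by rewrite natr1 prednK.
  by rewrite {1}hE => ->; rewrite mulrDl mul1r addrK.
rewrite -(ler_pM2r m0).
have -> : (h / m - e / 2) * (m + dl * 2) * m = h * m - e * m ^+ 2 / 2 + dl * h * 2 - dl * (e * m).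
  by field; rewrite gt_eqF.
lra.
Qed.

End blackwell.

(** * Growth from increments *)

Section stolz.
Context {R : realType}.
Implicit Types (a g : R -> R) (l b c e T : R).

Lemma cvg_pinftyP g l : g t @[t --> +oo] --> l <->
  forall e, 0 < e -> exists T, forall t, T <= t -> l - e <= g t <= l + e.
Proof.
split.
  move=> gl e e0; have /cvgrPdist_le/(_ e e0)[T [_ TP]] := gl.
  exists (T + 1) => t Tt; have := TP t (ltac:(lra)).
  by rewrite /= ler_norml => /andP[h1 h2]; apply/andP; split; lra.
move=> H; apply/cvgrPdist_le => e e0; have [T TP] := H e e0.
exists T; split; first exact: num_real.
move=> t /ltW/TP/andP[h1 h2] /=; rewrite ler_norml; apply/andP; split; lra.
Qed.

Lemma cvg_pinfty_le g (g' : R -> R) l : g t @[t --> +oo] --> l ->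
  (exists T, forall t, T <= t -> g' t <= g t) ->
  forall e, 0 < e -> exists T, forall t, T <= t -> g' t <= l + e.
Proof.
move=> /cvg_pinftyP gl [T0 gg'] e e0; have [T TP] := gl e e0.
exists (Num.max T0 T) => t; rewrite ge_max => /andP[t0 t1].
by have /andP[_] := TP t t1; apply: le_trans; exact: gg'.
Qed.

Lemma cvg_pinfty_ge g (g' : R -> R) l : g t @[t --> +oo] --> l ->
  (exists T, forall t, T <= t -> g t <= g' t) ->
  forall e, 0 < e -> exists T, forall t, T <= t -> l - e <= g' t.
Proof.
move=> /cvg_pinftyP gl [T0 gg'] e e0; have [T TP] := gl e e0.
exists (Num.max T0 T) => t; rewrite ge_max => /andP[t0 t1].
by have /andP[h _] := TP t t1; apply: (le_trans h); exact: gg'.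
Qed.

Lemma cvg_pinfty_shift g l b : g t @[t --> +oo] --> l -> g (t + b) @[t --> +oo] --> l.
Proof.
move=> /cvg_pinftyP gl; apply/cvg_pinftyP => e /gl[T TP].
by exists (T - b) => t Tt; apply: TP; lra.
Qed.

Lemma cvg_pinfty_mul (g g' : R -> R) l l' : g t @[t --> +oo] --> l ->
  g' t @[t --> +oo] --> l' -> g t * g' t @[t --> +oo] --> l * l'.
Proof. by move=> gl gl'; exact: cvgM. Qed.

Lemma cvg_inv_pow k : (t ^+ k.+1)^-1 @[t --> +oo] --> (0 : R).
Proof.
apply/cvg_pinftyP => e e0; exists (Num.max 1 e^-1) => t; rewrite ge_max => /andP[t1 te].
have t0 : 0 < t by lra.
have tk : t <= t ^+ k.+1 by rewrite ler_eXnr.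
have h0 : 0 <= (t ^+ k.+1)^-1 by rewrite invr_ge0 exprn_ge0 // ltW.
have h1 : (t ^+ k.+1)^-1 <= e.
  by rewrite invf_ple ?posrE ?exprn_gt0// (le_trans te).
by apply/andP; split; lra.
Qed.

Lemma cvg_pow_ratio b k : ((t + b) / t) ^+ k @[t --> +oo] --> (1 : R).
Proof.
have h : (t + b) / t @[t --> +oo] --> (1 : R).
  have : 1 + b * (t ^+ 1)^-1 @[t --> +oo] --> (1 + b * 0 : R).
    by apply: cvgD; [exact: cvg_cst|apply: cvgM; [exact: cvg_cst|exact: cvg_inv_pow]].
  rewrite mulr0 addr0 => /cvg_pinftyP H; apply/cvg_pinftyP => e /H[T TP].
  exists (Num.max 1 T) => t; rewrite ge_max => /andP[t1 /TP].
  by rewrite expr1 mulrDl mulfV//; lra.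
elim: k => [|k IH].
  rewrite (_ : (fun t => _) = cst 1); first exact: cvg_cst.
  by apply/funext => t; rewrite expr0.
have := cvg_pinfty_mul h IH; rewrite mulr1.
rewrite [X in X @ _ --> _ -> _](_ : _ = fun t => ((t + b) / t) ^+ k.+1)//.
by apply/funext => t; rewrite exprS.
Qed.

Lemma cvg_monomial_shift g k l b : g t / t ^+ k @[t --> +oo] --> l ->
  g (t + b) / t ^+ k @[t --> +oo] --> l.
Proof.
move=> /(@cvg_pinfty_shift _ _ b) gl.
have := cvg_pinfty_mul gl (cvg_pow_ratio b k); rewrite mulr1 => /cvg_pinftyP H.
apply/cvg_pinftyP => e /H[T TP]; exists (Num.max (Num.max 1 (1 - b)) T) => t.
rewrite !ge_max => /andP[/andP[t1 tb] /TP] /=.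
have t0 : t + b != 0 by rewrite gt_eqF//; lra.
by rewrite expr_div_n mulrA divfK// expf_neq0.
Qed.

Lemma ler_succ_pow k (t : R) : 0 <= t -> k.+1%:R * t ^+ k <= (t + 1) ^+ k.+1 - t ^+ k.+1.
Proof.
move=> t0; elim: k => [|k IH]; first by rewrite expr0 !expr1; lra.
have h1 : 0 <= t ^+ k by exact: exprn_ge0.
have h2 : 0 <= k.+1%:R * t ^+ k by rewrite mulr_ge0.
have h3 : (t + 1) * (t ^+ k.+1 + k.+1%:R * t ^+ k) <= (t + 1) * (t + 1) ^+ k.+1.
  by rewrite ler_wpM2l; lra.
rewrite [(t + 1) ^+ k.+2]exprS; apply: le_trans (lerB h3 (lexx _)).
have -> : k.+2%:R * t ^+ k.+1 = k.+1%:R * t * t ^+ k + t ^+ k.+1 :> R.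
  by rewrite -natr1 mulrDl mul1r exprS mulrA.
rewrite !exprS; move: h2; set u := t ^+ k; set n := k.+1%:R; lra.
Qed.

Lemma ler_pow_pred k (t : R) : 0 <= t -> (t + 1) ^+ k.+1 - t ^+ k.+1 <= k.+1%:R * (t + 1) ^+ k.
Proof.
move=> t0; elim: k => [|k IH]; first by rewrite expr0 !expr1; lra.
have h1 : t ^+ k.+1 <= (t + 1) ^+ k.+1 by rewrite lerXn2r ?nnegrE; lra.
have h3 : (t + 1) * ((t + 1) ^+ k.+1 - t ^+ k.+1) <= (t + 1) * (k.+1%:R * (t + 1) ^+ k).
  by rewrite ler_wpM2l; lra.
have -> : k.+2%:R * (t + 1) ^+ k.+1 = (t + 1) * (k.+1%:R * (t + 1) ^+ k) + (t + 1) ^+ k.+1 :> R.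
  by rewrite [(t + 1) ^+ k.+1]exprS -[k.+2%:R]natr1; ring.
have -> : (t + 1) ^+ k.+2 - t ^+ k.+2 = (t + 1) * ((t + 1) ^+ k.+1 - t ^+ k.+1) + t ^+ k.+1.
  by rewrite !(exprS _ k.+1); ring.
lra.
Qed.

Lemma unit_step_bound (b : R -> R) T M : (forall t, T <= t -> b t <= b (t - 1)) ->
  (forall s, T - 1 <= s <= T -> b s <= M) -> forall t, T <= t -> b t <= M.
Proof.
move=> bs bM t Tt.
have H n : forall s, T - 1 <= s -> s <= T + n%:R -> b s <= M.
  elim: n => [|n IH] s s1 s2; first by apply: bM; rewrite s1; lra.
  have [sn|sn] := leP s (T + n%:R); first exact: IH.
  have n0 : 0 <= n%:R :> R by [].
  rewrite -natr1 in s2.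
  by apply: (le_trans (bs s _)); [lra|apply: IH; lra].
have tT : 0 <= t - T by lra.
have /andP[_ h] := truncn_itv tT.
by apply: (H (Num.truncn (t - T)).+1); lra.
Qed.

(** Between t - 1 and t, the function (t + 1)^(k+1) increases by at least (k + 1) t^k,
    and t^(k+1) by at most (k + 1) t^k. So the difference between a and a suitable
    multiple of one of these powers is monotone along unit steps, and it is bounded on
    an initial interval of length 1 because a is monotone and nonnegative. *)
Lemma stolz_monomial a k c : (forall t, 0 <= a t) -> {homo a : x y / x <= y} ->
  (a t - a (t - 1)) / t ^+ k @[t --> +oo] --> c ->
  a t / t ^+ k.+1 @[t --> +oo] --> c / k.+1%:R.
Proof.
move=> a0 aI /cvg_pinftyP ac.
have c0 : 0 <= c.
  apply/ler_addgt0Pr => e e0; have [T TP] := ac e e0.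
  have /andP[_] := TP (Num.max T 1) (ltac:(by rewrite le_max lexx)).
  apply: le_trans; rewrite divr_ge0//; first by rewrite subr_ge0 aI; lra.
  by rewrite exprn_ge0// le_max ler01 orbT.
have k0 : 0 < k.+1%:R :> R by [].
have bound e : 0 < e -> exists2 T, 1 <= T & forall t, T <= t ->
   (c - e) * t ^+ k <= a t - a (t - 1) <= (c + e) * t ^+ k.
  move=> e0; have [T TP] := ac e e0; exists (Num.max 1 T); first by rewrite le_max lexx.
  move=> t; rewrite ge_max => /andP[t1 /TP].
  by rewrite ler_pdivlMr ?ler_pdivrMr// exprn_gt0//; lra.
have upper e : 0 < e -> exists T, forall t, T <= t -> a t / t ^+ k.+1 <= c / k.+1%:R + e.
  move=> e0; pose e1 := e / 2; have e10 : 0 < e1 by rewrite divr_gt0.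
  have [T T1 TP] := bound e1 e10.
  have ce : 0 <= c + e1 by lra.
  pose d := (c + e1) / k.+1%:R.
  have d0 : 0 <= d by rewrite divr_ge0.
  have key t : T <= t -> a t - d * (t + 1) ^+ k.+1 <= a T.
    move=> Tt; apply: (@unit_step_bound (fun t => a t - d * (t + 1) ^+ k.+1) T) => // s.
      move=> Ts; have /andP[_ h] := TP s Ts.
      have := ler_succ_pow k (ltac:(lra) : 0 <= s) => /(ler_wpM2l d0).
      rewrite mulrA divfK ?gt_eqF// mulrBr subrK; lra.
    move=> /andP[s1 s2]; have := aI _ _ s2.
    have : 0 <= d * (s + 1) ^+ k.+1 by rewrite mulr_ge0// exprn_ge0//; lra.
    lra.
  have lim : a T * (t ^+ k.+1)^-1 + d * ((t + 1) / t) ^+ k.+1 @[t --> +oo] --> a T * 0 + d * 1.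
    apply: cvgD; apply: cvgM; [exact: cvg_cst|exact: cvg_inv_pow|exact: cvg_cst|exact: cvg_pow_ratio].
  have [|T' TP'] := @cvg_pinfty_le _ (fun t => a t / t ^+ k.+1) _ lim _ e1 e10.
    exists T => t Tt; have t0 : 0 < t ^+ k.+1 by rewrite exprn_gt0//; lra.
    rewrite expr_div_n mulrA -mulrDl ler_pM2r ?invr_gt0//.
    have := key t Tt; lra.
  exists T' => t /TP' /le_trans; apply; rewrite mulr0 mulr1 add0r.
  have : e1 / k.+1%:R <= e1 by rewrite ler_pdivrMr//; apply: ler_peMr; [exact: ltW|rewrite ler1n].
  have : e1 + e1 = e by rewrite /e1; lra.
  rewrite /d mulrDl; move: (e1 / k.+1%:R) (c / k.+1%:R) => u v; lra.
have lower e : 0 < e -> exists T, forall t, T <= t -> c / k.+1%:R - e <= a t / t ^+ k.+1.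
  (* e1 <= c keeps the coefficient of the comparison power nonnegative *)
  move=> e0; pose e1 := Num.min (e / 2) c.
  have [c00|cpos] := leP c 0.
    exists 1 => t t1; apply: (@le_trans _ _ 0).
      have -> : c = 0 by lra.
      by rewrite mul0r; lra.
    by rewrite divr_ge0// exprn_ge0; lra.
  have e10 : 0 < e1 by rewrite lt_min cpos divr_gt0.
  have e1c : e1 <= c by rewrite ge_min lexx orbT.
  have e1e : e1 <= e / 2 by rewrite ge_min lexx.
  have [T T1 TP] := bound e1 e10.
  pose d := (c - e1) / k.+1%:R.
  have d0 : 0 <= d by rewrite divr_ge0//; lra.
  have key t : T <= t -> d * t ^+ k.+1 - a t <= d * T ^+ k.+1.
    move=> Tt; apply: (@unit_step_bound (fun t => d * t ^+ k.+1 - a t) T) => // s.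
      move=> Ts; have /andP[h _] := TP s Ts.
      have := ler_pow_pred k (ltac:(lra) : 0 <= s - 1) => /(ler_wpM2l d0).
      rewrite subrK [d * (_ * _)]mulrA divfK ?gt_eqF// mulrBr; lra.
    move=> /andP[s1 s2]; have := a0 s.
    have : d * s ^+ k.+1 <= d * T ^+ k.+1 by rewrite ler_wpM2l// lerXn2r ?nnegrE; lra.
    lra.
  have lim : d - (d * T ^+ k.+1) * (t ^+ k.+1)^-1 @[t --> +oo] --> d - (d * T ^+ k.+1) * 0.
    by apply: cvgB; [exact: cvg_cst|apply: cvgM; [exact: cvg_cst|exact: cvg_inv_pow]].
  have e20 : 0 < e / 2 by lra.
  have [|T' TP'] := @cvg_pinfty_ge _ (fun t => a t / t ^+ k.+1) _ lim _ (e / 2) e20.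
    exists T => t Tt; have t0 : 0 < t ^+ k.+1 by rewrite exprn_gt0//; lra.
    rewrite ler_pdivlMr// mulrBl divfK ?gt_eqF//.
    have := key t Tt; lra.
  exists T' => t /TP'; apply: le_trans; rewrite mulr0 subr0.
  have : e1 / k.+1%:R <= e1 by rewrite ler_pdivrMr//; apply: ler_peMr; [exact: ltW|rewrite ler1n].
  rewrite /d mulrBl; move: (e1 / k.+1%:R) (c / k.+1%:R) => u v; lra.
apply/cvg_pinftyP => e e0; have [T1 h1] := upper e e0; have [T2 h2] := lower e e0.
exists (Num.max T1 T2) => t; rewrite ge_max => /andP[t1 t2].
by rewrite h1// h2.
Qed.

End stolz.

(** * Growth of the generations *)

Section generations.
Context {R : realType}.
Variables (F G : probability R R) (m : R).
Hypothesis F_gt0 : F `]-oo, 0]%classic = 0%E.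
Hypothesis G_gt0 : G `]-oo, 0]%classic = 0%E.
Hypothesis F_nonlattice : nonlattice F.
Hypothesis mean : (\int[F]_y (Num.max 0 y)%:E = m%:E)%E.

Local Notation W := (renewal F G).
Let cW : convop W := convop_renewal F_gt0 G_gt0.
Let cWj j : convop (fun f => iter j W f) := convop_iter j cW.
Let m0 : 0 < m := mean_gt0 F_gt0 mean.

(** The mean number of individuals of generation j born up to t: generation 0
    consists of the ancestor alone, whose count is the unit step. *)
Definition generation_size j t : R := fine (iter j W step t).
Local Notation v := generation_size.

Lemma generation_size_fin j t : iter j W step t = (v j t)%:E.
Proof.
(* the exponential is an eigenfunction of W and dominates the unit step *)
have [c c0 cE] := renewal_expR F_gt0 G_gt0.
have mexp : nnmeas (EFin \o @expR R).
  by split; [exact/measurable_EFinP|move=> x; rewrite lee_fin expR_ge0].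
have E x : iter j W (EFin \o expR) x = (c ^+ j * expR x)%:E.
  elim: j x => [|j IH] x; first by rewrite expr0 mul1r.
  have -> : iter j.+1 W (EFin \o expR) = W (fun x => (c ^+ j)%:E * (EFin \o expR) x)%E.
    by rewrite iterS; congr (W _); apply/funext => y; rewrite IH EFinM.
  by rewrite (convop_scale cW) ?exprn_ge0// cE muleA -!EFinM exprSr.
rewrite fineK// ge0_fin_numE; last exact: (convop_nnmeas (cWj j) nnmeas_step).2.
apply: le_lt_trans (ltry (c ^+ j * expR t)); rewrite -E.
by apply: (convop_le (cWj j)) => //; [exact: nnmeas_step|exact: step_le_expR].
Qed.

Lemma generation_size_ge0 j t : 0 <= v j t.
Proof. by rewrite -lee_fin -generation_size_fin; exact: (convop_nnmeas (cWj j) nnmeas_step).2. Qed.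

Lemma generation_size_homo j : {homo v j : x y / x <= y}.
Proof.
move=> x y xy; rewrite -lee_fin -!generation_size_fin.
have -> : iter j W step y = iter j W (fun z => step (z + (y - x))) x.
  by rewrite (convop_shift (cWj j) (f := step)) ?subrKC//; exact: nnmeas_step.
apply: (convop_le (cWj j)); [exact: nnmeas_step|apply: nnmeas_shift; exact: nnmeas_step|].
move=> z; rewrite /step lee_fin; case: (leP 0 z) => z0; last exact: ler0n.
by have -> : 0 <= z + (y - x) by lra.
Qed.

Lemma generation_size_box j h t : 0 <= h ->
  iter j W (box h) t = (v j t - v j (t - h))%:E.
Proof.
move=> h0; rewrite EFinB -!generation_size_fin.
have nh : nnmeas (fun z => step (z + - h)) by apply: nnmeas_shift; exact: nnmeas_step.
have -> : iter j W step t = (iter j W (box h) t + iter j W (fun z => step (z + - h)) t)%E.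
  rewrite -(convop_add (cWj j))//; last exact: nnmeas_box.
  congr (iter j W _ t); apply/funext => z; rewrite /box /step -EFinD.
  case: (leP 0 z) => z0; case: (ltP z h) => zh /=; case: (leP 0 (z + - h)) => zh' /=;
    rewrite ?addr0 ?add0r//; exfalso; lra.
rewrite (convop_shift (cWj j) (f := step)); last exact: nnmeas_step.
by rewrite addeK// generation_size_fin.
Qed.

(** Increments are taken backward because they are then the images of boxes by W^j
    ([generation_size_box]). *)
Definition increments_rate j c := forall h, 0 < h ->
  (v j.+1 t - v j.+1 (t - h)) / t ^+ j @[t --> +oo] --> h * c.

Lemma increments_rate_size j c : increments_rate j c ->
  v j.+1 t / t ^+ j.+1 @[t --> +oo] --> c / j.+1%:R.
Proof.
move=> /(_ 1 ltr01); rewrite mul1r; apply: stolz_monomial.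
  exact: generation_size_ge0.
exact: generation_size_homo.
Qed.

Lemma increments_rate0 : increments_rate 0 m^-1.
Proof.
move=> h h0; apply/cvg_pinftyP => e e0.
have [T TP] := blackwell F_gt0 G_gt0 F_nonlattice mean h0 e0.
exists T => t /TP; rewrite expr0 divr1.
have := generation_size_box 1 t (ltW h0); rewrite /= => ->.
by rewrite !lee_fin.
Qed.

(** Blackwell's theorem as a pair of pointwise inequalities. The errors are of the two
    kinds that W^j preserves: a small multiple of the unit step, which becomes a small
    multiple of V_j, and a multiple of a fixed box, which becomes an increment of V_j. *)
Lemma renewal_box_squeeze h e : 0 < h -> 0 < e -> exists T C : R, [/\ 0 < T, 0 <= C,
  forall x, (W (box h) x <= (h / m + e)%:E * step x + C%:E * box T x)%E &
  forall x, ((Num.max 0 (h / m - e))%:E * step x <= W (box h) x + C%:E * box T x)%E].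
Proof.
move=> h0 e0.
have hm : 0 < h / m by rewrite divr_gt0.
have [T0 TP] := blackwell F_gt0 G_gt0 F_nonlattice mean h0 e0.
have [C0 C00 CP] := renewal_box_bounded F_gt0 G_gt0 h.
have nb : nnmeas (box h) := nnmeas_box h.
have pos x := (convop_nnmeas cW nb).2 x.
have zero x : x < 0 -> W (box h) x = 0%E.
  move=> x0; apply: (convop_causal cW) => // y y0.
  by rewrite /box leNgt y0.
exists (Num.max 1 T0), (C0 + h / m); split.
- by rewrite lt_max ltr01.
- by rewrite addr_ge0// ltW.
- move=> x; rewrite /step /box; have [x0|x0] := leP 0 x; last by rewrite zero// !mule0 adde0.
  have [xT|xT] := ltP x (Num.max 1 T0) => /=.
    by rewrite !mule1 -EFinD (le_trans (CP x))// lee_fin; lra.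
  rewrite mule0 adde0 mule1; move: xT; rewrite ge_max => /andP[_ /TP/andP[_]].
  exact.
- move=> x; rewrite /step /box; have [x0|x0] := leP 0 x; last by rewrite zero// !mule0 adde0.
  have [xT|xT] := ltP x (Num.max 1 T0) => /=.
    rewrite !mule1 -[leLHS]add0e; apply: leeD => //.
    by rewrite lee_fin ge_max; apply/andP; split; lra.
  rewrite mule0 adde0 mule1; move: xT; rewrite ge_max => /andP[_ /TP/andP[h1 _]].
  by case: (leP 0 (h / m - e)).
Qed.

(** The increments of generation j + 2 are W^(j+1) (W 1_[0,h[). In the squeeze of
    W 1_[0,h[, the multiple of the unit step contributes (h / m + o(1)) V_(j+1), and the
    box contributes an increment of V_(j+1), which is of order t^j. *)
Lemma increments_rateS j c : increments_rate j c ->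
  increments_rate j.+1 (c / j.+1%:R / m).
Proof.
move=> rc h h0; have vlim := increments_rate_size rc.
apply/cvg_pinftyP => e e0.
have c0 : 0 <= c / j.+1%:R.
  move/cvg_pinftyP: vlim => vlim; apply/ler_addgt0Pr => e1 e10.
  have [T TP] := vlim e1 e10.
  have /andP[_] := TP (Num.max T 1) (ltac:(by rewrite le_max lexx)).
  apply: le_trans; rewrite divr_ge0 ?generation_size_ge0//.
  by rewrite exprn_ge0// le_max ler01 orbT.
pose l := c / j.+1%:R; pose e1 := e / 2 / (l + 1).
have l0 : 0 <= l := c0.
have l1 : 0 < l + 1 by lra.
have e10 : 0 < e1 by rewrite !divr_gt0.
have e20 : 0 < e / 2 by rewrite divr_gt0.
have e1l : e1 * l <= e / 2.
  by rewrite /e1 mulrAC ler_pdivrMr// ler_wpM2l//; [exact: ltW|rewrite lerDl].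
have [T [C [T0 C0 up lo]]] := renewal_box_squeeze h0 e10.
have hm : 0 < h / m by rewrite divr_gt0.
have hme : 0 <= h / m + e1 by lra.
have hm0 : 0 <= Num.max 0 (h / m - e1) by rewrite le_max lexx.
have nb : nnmeas (W (box h)) by apply: (convop_nnmeas cW); exact: nnmeas_box.
have nbT k : 0 <= k -> nnmeas (fun x => k%:E * box T x)%E.
  by move=> k0; apply: nnmeasZ => //; exact: nnmeas_box.
have nst k : 0 <= k -> nnmeas (fun x => k%:E * step x)%E.
  by move=> k0; apply: nnmeasZ => //; exact: nnmeas_step.
pose D t := v j.+1 t - v j.+1 (t - T).
have iterE t : iter j.+1 W (W (box h)) t = (v j.+2 t - v j.+2 (t - h))%:E.
  by rewrite -iterSr generation_size_box// ltW.
have Dlim : D t * (t ^+ j.+1)^-1 @[t --> +oo] --> 0.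
  have := cvg_pinfty_mul (rc T T0) (cvg_inv_pow 0); rewrite mulr0 => /cvg_pinftyP H.
  apply/cvg_pinftyP => e3 /H[T3 T3P]; exists (Num.max 1 T3) => t.
  rewrite ge_max => /andP[t1 /T3P]; rewrite expr1 exprS invfM mulrA.
  by rewrite [_ / t / _]mulrAC.
have [T1 T1P] : exists T1, forall t, T1 <= t ->
    (v j.+2 t - v j.+2 (t - h)) / t ^+ j.+1 <= (h / m + e1) * l + C * 0 + e / 2.
  have lim : (h / m + e1) * (v j.+1 t / t ^+ j.+1) + C * (D t * (t ^+ j.+1)^-1) @[t --> +oo]
      --> (h / m + e1) * l + C * 0.
    by apply: cvgD; apply: cvgM => //; exact: cvg_cst.
  apply: (cvg_pinfty_le (g' := fun t => (v j.+2 t - v j.+2 (t - h)) / t ^+ j.+1) lim _ e20).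
  exists 1 => t t1; rewrite !mulrA -mulrDl ler_wpM2r//.
    by rewrite invr_ge0 exprn_ge0; lra.
  rewrite -lee_fin -iterE EFinD !EFinM -generation_size_fin -(generation_size_box _ _ (ltW T0)).
  rewrite -!(convop_scale (cWj j.+1))//; [|exact: nnmeas_box|exact: nnmeas_step].
  rewrite -(convop_add (cWj j.+1)); [|exact: nst|exact: nbT].
  by apply: (convop_le (cWj j.+1)); [exact: nb|apply: nnmeasD; [exact: nst|exact: nbT]|].
have [T2 T2P] : exists T2, forall t, T2 <= t ->
    Num.max 0 (h / m - e1) * l - C * 0 - e / 2 <= (v j.+2 t - v j.+2 (t - h)) / t ^+ j.+1.
  have lim : Num.max 0 (h / m - e1) * (v j.+1 t / t ^+ j.+1) - C * (D t * (t ^+ j.+1)^-1) @[t --> +oo]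
      --> Num.max 0 (h / m - e1) * l - C * 0.
    by apply: cvgB; apply: cvgM => //; exact: cvg_cst.
  apply: (cvg_pinfty_ge (g' := fun t => (v j.+2 t - v j.+2 (t - h)) / t ^+ j.+1) lim _ e20).
  exists 1 => t t1; rewrite !mulrA -mulrBl ler_wpM2r//.
    by rewrite invr_ge0 exprn_ge0; lra.
  rewrite lerBlDr -lee_fin EFinD -iterE !EFinM -generation_size_fin -(generation_size_box _ _ (ltW T0)).
  rewrite -!(convop_scale (cWj j.+1))//; [|exact: nnmeas_box|exact: nnmeas_step].
  rewrite -(convop_add (cWj j.+1)); [|exact: nb|exact: nbT].
  by apply: (convop_le (cWj j.+1)); [exact: nst|apply: nnmeasD; [exact: nb|exact: nbT]|].
exists (Num.max T1 T2) => t; rewrite ge_max => /andP[/T1P h1 /T2P h2].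
have E : h * (l / m) = h / m * l by rewrite mulrA mulrAC.
rewrite -/l E; apply/andP; split.
  apply: le_trans h2; rewrite mulr0 subr0.
  have : (h / m - e1) * l <= Num.max 0 (h / m - e1) * l.
    by rewrite ler_wpM2r// le_max lexx orbT.
  rewrite mulrBl; lra.
apply: (le_trans h1); rewrite mulr0 addr0 mulrDl; lra.
Qed.

Lemma increments_rate_all j : increments_rate j (j`!%:R * m ^+ j.+1)^-1.
Proof.
elim: j => [|j IH]; first by rewrite mul1r expr1; exact: increments_rate0.
have := increments_rateS IH.
rewrite (_ : _ / m = (j.+1`!%:R * m ^+ j.+2)^-1)//.
rewrite factS natrM [m ^+ j.+2]exprSr !invfM.
by move: (j`!%:R^-1) (j.+1%:R^-1) (m^-1) ((m ^+ j.+1)^-1) => x y z u; ring.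
Qed.

Theorem generation_increment j h : 0 < h ->
  (v j.+1 (t + h) - v j.+1 t) / t ^+ j @[t --> +oo] --> h / (j`!%:R * m ^+ j.+1).
Proof.
move=> h0; move: (@cvg_monomial_shift _ _ _ _ h (@increments_rate_all j h h0)).
apply: cvg_trans; apply: near_eq_cvg; apply: nearW => t /=.
by rewrite addrK.
Qed.

End generations.

(** * Mean generation counts as iterates of the renewal operator *)

Section countable_sums.
Context {R : realType}.

(** Turns sums over words into series, for which the exchange with integrals is
    available. *)
Lemma esum_pickle (T : countType) (g : T -> \bar R) : (forall u, 0 <= g u)%E ->
  (\esum_(u in [set: T]) g u =
   \sum_(n <oo) if choice.pickle_inv n is Some u then g u else 0)%E.
Proof.
move=> g0; pose a (n : nat) : \bar R := if choice.pickle_inv n is Some u then g u else 0%E.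
have a0 n : (0 <= a n)%E by rewrite /a; case: (choice.pickle_inv n).
rewrite nneseries_esumT//.
have -> : (\esum_(n in [set: nat]) a n = \esum_(n in range (@choice.pickle T)) a n)%E.
  rewrite [RHS]esum_mkcond; apply: eq_esum => n _.
  case: ifPn => // /negP nr; rewrite /a; case E : (choice.pickle_inv n) => [u|//].
  case: nr; rewrite inE; exists u => //.
  by have := @choice.pickle_invK T n; rewrite E.
rewrite (@reindex_esum _ _ _ [set: T] (range (@choice.pickle T)) choice.pickle a).
  by apply: eq_esum => u _; rewrite /a choice.pickleK_inv.
split => [u _|u v _ _ /(pcan_inj choice.pickleK)//|n [u _ <-]]; first by exists u.
by exists u.
Qed.

Lemma counting_esum (T : choiceType) (S : set T) :
  (counting S = \esum_(u in [set: T]) (\1_S u : R)%:E)%E.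
Proof.
rewrite (_ : (\esum_(u in [set: T]) (\1_S u : R)%:E = \esum_(u in S) 1)%E); last first.
  rewrite [RHS]esum_mkcond; apply: eq_esum => u _; rewrite indicE.
  by case: (u \in S).
rewrite /counting; case: ifPn => /asboolP finS.
  rewrite esum_fset// fsbig_finite//= sumEFin card_fset_sum1; congr EFin.
  by rewrite natr_sum.
apply/esym/eqyP => r r0.
have [B BS Br] := infinite_set_fset (Num.truncn r).+1 finS.
apply: esum_ge; exists [set` B] => //.
apply: (@le_trans _ _ (Num.truncn r).+1%:R%:E); first by rewrite lee_fin ltW// truncnS_gt.
rewrite fsbig_finite//= set_fsetK sumEFin lee_fin.
have -> : \sum_(i <- B) 1 = (#|` B|)%:R :> R by rewrite card_fset_sum1 natr_sum.
by rewrite ler_nat.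
Qed.

End countable_sums.

Section branching.
Context {R : realType} d (Omega : measurableType d) (P : probability Omega R).
Variables (xi eta : {RV P >-> R}) (xis etas : nat -> {RV P >-> R}).
Variable T : seq nat -> nat -> {RV P >-> R}.
Hypothesis xis_etas_copies : independent_copies P (fun w => (xi w, eta w))
         (fun (i : nat) w => (xis i w, etas i w)).
Hypothesis T_copies : independent_copies P
         (as_random_sequence (perturbed_walk xis etas))
         (fun u : seq nat => as_random_sequence (T u)).
Hypothesis xi_gt0 : distribution P xi `]-oo, 0]%classic = 0%E.
Hypothesis eta_gt0 : distribution P eta `]-oo, 0]%classic = 0%E.

Let A := conv (distribution P xi).
Let B := conv (distribution P eta).
Let cA : convop A := convop_convF xi_gt0.
Let cB : convop B := convop_convF eta_gt0.
Local Notation W := (renewal (distribution P xi) (distribution P eta)).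

Lemma measurable_cylinder i (C : set R) : measurable C ->
  measurable [set x : real_sequences R | C (x i)].
Proof. by move=> mC; apply: sub_gen_smallest; exists i, C. Qed.

Lemma conv_child u i f : nnmeas f -> conv (distribution P (T u i)) f = iter i A (B f).
Proof.
move=> mf; rewrite -(conv_walk xis_etas_copies cA cB i mf).
apply: eq_conv_distribution => C mC.
have := T_copies.2 u _ (measurable_cylinder i mC).
rewrite /preimage/as_random_sequence/= => ->.
congr (P _); apply/funext => w.
change (C (perturbed_walk xis etas i w) = C (walk xis etas i w)).
by rewrite walkE.
Qed.

Section line.
Variables (n : nat) (v : seq nat).
Let ages k : {RV P >-> R} := T (take k v) (nth 0%N v k).

(** Along one line of descent the mothers are the prefixes of a word. They are distinct
    since their lengths are, and so their offspring sequences are independent. *)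
Let ages_indep : (n <= size v)%N -> independent_below ages n.
Proof.
move=> nv C mC.
pose D (u : seq nat) : set (real_sequences R) := [set x | C (size u) (x (nth 0%N v (size u)))].
have mD u : measurable (D u) by apply: measurable_cylinder.
have szt k : (k < n)%N -> size (take k v) = k.
  by move=> kn; rewrite size_takel// ltnW// (leq_trans kn).
have := mutually_independent_below (g := take^~ v) (N := n) T_copies.1 _ mD.
have inj : {in gtn n &, injective (take^~ v)}.
  by move=> k l kn ln /(congr1 size); rewrite !szt.
move=> /(_ inj); rewrite /D /preimage /as_random_sequence /=.
have -> : (\prod_(0 <= k < n) P [set w | C (size (take k v)) (T (take k v) (nth 0%N v (size (take k v))) w)]
   = \prod_(0 <= k < n) P (ages k @^-1` C k))%E.
  by rewrite !big_nat; apply: eq_bigr => k /andP[_ kn]; rewrite szt.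
move=> <-; congr (P _); apply/seteqP; split => w /= h k kn; have := h k kn; by rewrite szt.
Qed.

Lemma integral_lineS k f t : (k < n)%N -> (n <= size v)%N -> nnmeas f ->
  (\int[P]_w f (t - \sum_(i < k.+1) T (take i v) (nth 0%N v i) w)%R =
   \int[P]_w iter (nth 0%N v k) A (B f) (t - \sum_(i < k) T (take i v) (nth 0%N v i) w)%R)%E.
Proof.
move=> kn nv mf; have := integral_prefix_sumS (ages_indep nv) t kn mf.
by rewrite (conv_child _ _ mf).
Qed.

End line.

Lemma birth_timeE j (u : j.-tuple nat) w :
  birth_time T u w = \sum_(i < j) T (take i u) (nth 0%N u i) w.
Proof. by apply: eq_bigr => i _; rewrite (tnth_nth 0%N). Qed.

Lemma integral_birth_rcons j (u : j.-tuple nat) i f t : nnmeas f ->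
  (\int[P]_w f (t - birth_time T [tuple of rcons u i] w)%R =
   \int[P]_w iter i A (B f) (t - birth_time T u w)%R)%E.
Proof.
move=> mf; under eq_integral do rewrite birth_timeE.
rewrite (@integral_lineS j.+1 [tuple of rcons u i] j f t)//; last by rewrite size_tuple.
rewrite /= nth_rcons size_tuple ltnn eqxx.
apply: eq_integral => w _; congr (iter i A (B f) (t - _)); rewrite birth_timeE.
apply: eq_bigr => k _; rewrite nth_rcons size_tuple ltn_ord.
by rewrite -cats1 takel_cat// size_tuple ltnW.
Qed.

Lemma measurable_birth_time j (u : j.-tuple nat) : measurable_fun setT (birth_time T u).
Proof. by apply: measurable_sum. Qed.

Lemma nnmeas_birth j (u : j.-tuple nat) f t : nnmeas f ->
  measurable_fun setT (fun w => f (t - birth_time T u w)).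
Proof.
move=> [mf _]; apply: measurableT_comp => //; apply: measurable_funB => //.
exact: measurable_birth_time.
Qed.

(** Summation over the last letter replaces f by W f, which reduces generation j + 1 to
    generation j. *)
Lemma esum_generation j f t : nnmeas f ->
  (\esum_(u in [set: j.-tuple nat]) \int[P]_w f (t - birth_time T u w)%R)%E = iter j W f t.
Proof.
have cW := convop_renewal xi_gt0 eta_gt0.
elim: j f t => [|j IH] f t mf.
  rewrite (_ : [set: 0.-tuple nat] = [set [tuple]]); last first.
    by apply/seteqP; split => u // _ /=; rewrite tuple0.
  rewrite esum_set1; last by apply: integral_ge0 => w _; exact: mf.2.
  have -> : (\int[P]_w f (t - birth_time T [tuple] w)%R = \int[P]_(w in setT) (cst (f t)) w)%E.
    by apply: eq_integral => w _; rewrite /birth_time big_ord0 subr0.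
  by rewrite integral_cst//= probability_setT mule1.
have nAB i : nnmeas (iter i A (B f)).
  by apply: (convop_nnmeas (convop_iter i cA)); exact: convop_nnmeas cB _ mf.
pose e (p : j.-tuple nat * nat) : j.+1.-tuple nat := [tuple of rcons p.1 p.2].
rewrite (@reindex_esum _ _ _ ([set: j.-tuple nat] `*`` (fun=> [set: nat])) setT e); last first.
  split => //.
    move=> [u i] [u' i'] _ _ /(congr1 val)/= /rcons_inj[uu' ->].
    by congr (_, _); apply: val_inj.
  move=> u _; exists ([tuple of belast (thead u) (behead u)], last (thead u) (behead u)) => //.
  apply: val_inj; rewrite /= -lastI; case/tupleP: u => x u /=.
  by rewrite theadE.
rewrite -(@esum_esum _ _ _ setT (fun=> setT) (fun u i => \int[P]_w f (t - birth_time T (e (u, i)) w)%R)%E); last first.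
  by move=> u i _ _; apply: integral_ge0 => w _; exact: mf.2.
rewrite iterSr -IH; last exact: convop_nnmeas cW _ mf.
apply: eq_esum => u _.
rewrite -nneseries_esumT; last by move=> i; apply: integral_ge0 => w _; exact: mf.2.
rewrite /renewal integral_nneseries//.
- by apply: eq_eseriesr => i _; exact: integral_birth_rcons.
- by move=> i; exact: nnmeas_birth.
- by move=> i w _; exact: (nAB i).2.
Qed.

Lemma mean_generation_countE j t : 0 <= t ->
  mean_generation_count P T j t = iter j W step t.
Proof.
move=> t0; rewrite /mean_generation_count ltNge t0/= -esum_generation; last exact: nnmeas_step.
have E (u : j.-tuple nat) w : (\1_[set u : j.-tuple nat | birth_time T u w <= t] u : R)%:E
    = step (t - birth_time T u w).
  by rewrite /step subr_ge0 indicE mem_setE.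
have st0 x : (0 <= step x :> \bar R)%E by exact: nnmeas_step.2.
rewrite esum_pickle; last by move=> u; apply: integral_ge0.
transitivity (\int[P]_w \sum_(n <oo)
    if choice.pickle_inv n is Some u then step (t - birth_time T (u : j.-tuple nat) w)%R else 0)%E.
  apply: eq_integral => w _; rewrite /generation_count counting_esum.
  by rewrite esum_pickle//; apply: eq_eseriesr => n _; case: (choice.pickle_inv n) => // u; rewrite E.
rewrite integral_nneseries//.
- apply: eq_eseriesr => n _; case: (choice.pickle_inv n) => //; exact: integral0.
- by move=> n; case: (choice.pickle_inv n) => [u|] //; apply: nnmeas_birth; exact: nnmeas_step.
- by move=> n w _; case: (choice.pickle_inv n).
Qed.

End branching.

(** * Increments of the mean generation counts *)

Lemma distribution_gt0_null (R : realType) d (Omega : measurableType d) (P : probability Omega R)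
    (X : {RV P >-> R}) : {ae P, forall w, 0 < X w} ->
  distribution P X `]-oo, 0]%classic = 0%E.
Proof.
move=> X0; have mX : measurable (X @^-1` `]-oo, 0]).
  by rewrite -[Y in measurable Y]setTI; exact: measurable_funP.
apply: (measure_negligible mX); apply: negligibleS X0 => w /=.
by rewrite in_itv/= => h /lt_le_trans/(_ h); rewrite ltxx.
Qed.

Lemma positive_part_mean (R : realType) d (Omega : measurableType d) (P : probability Omega R)
    (X : {RV P >-> R}) : {ae P, forall w, 0 < X w} ->
  (\int[distribution P X]_y (Num.max 0 y)%:E = 'E_P[X])%E.
Proof.
move=> X0; rewrite ge0_integral_distribution/=; last 2 first.
- by apply/measurable_EFinP; exact: measurable_maxr.
- by move=> y; rewrite lee_fin le_max lexx.
rewrite expectation_def; apply: ae_eq_integral => //.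
- by apply/measurable_EFinP; exact: measurable_maxr.
- by apply/measurable_EFinP.
by apply: filterS X0 => w w0 _ /=; rewrite max_r// ltW.
Qed.

Theorem theorem2p4 (R : realType) (d : measure_display)
    (Omega : measurableType d) (P : probability Omega R)
    (xi eta : {RV P >-> R}) (xis etas : nat -> {RV P >-> R})
    (T : seq nat -> nat -> {RV P >-> R}) (m : R) (j : nat) (h : R)
    (xi_eta_gt0 : {ae P, forall w, 0 < xi w /\ 0 < eta w})
    (xis_etas_copies :
       independent_copies P (fun w => (xi w, eta w))
         (fun (i : nat) w => (xis i w, etas i w)))
    (T_copies :
       independent_copies P
         (as_random_sequence (perturbed_walk xis etas))
         (fun u : seq nat => as_random_sequence (T u)))
    (xi_nonlattice : nonlattice (distribution P xi))
    (xi_mean : ('E_P[xi] = m%:E)%E)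
    (j_gt0 : (0 < j)%N)
    (h_gt0 : 0 < h) :
  let V := mean_generation_count P T j in
  ((V (t + h)%R - V t) / (h * t ^+ j.-1 / ((j.-1)`!%:R * m ^+ j))%:E)%E
    @[t --> +oo] --> 1%E.
Proof.
have xi0 : {ae P, forall w, 0 < xi w} by apply: filterS xi_eta_gt0 => w [].
have eta0 : {ae P, forall w, 0 < eta w} by apply: filterS xi_eta_gt0 => w [].
have F0 := distribution_gt0_null xi0; have G0 := distribution_gt0_null eta0.
have mean := etrans (positive_part_mean xi0) xi_mean.
have m0 := mean_gt0 F0 mean.
case: j j_gt0 => // j _ /=.
pose v := generation_size (distribution P xi) (distribution P eta) j.+1.
have VE t : 0 <= t -> mean_generation_count P T j.+1 t = (v t)%:E.
  by move=> t0; rewrite (mean_generation_countE xis_etas_copies T_copies F0 G0)// generation_size_fin.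
have lim := @generation_increment _ _ _ _ F0 G0 xi_nonlattice mean j h h_gt0.
pose c := h / (j`!%:R * m ^+ j.+1).
have c0 : c != 0.
  by rewrite gt_eqF// divr_gt0// mulr_gt0 ?exprn_gt0// ltr0n fact_gt0.
have : (v (t + h) - v t) / t ^+ j * c^-1 @[t --> +oo] --> (1 : R).
  rewrite -(mulfV c0); apply: cvg_pinfty_mul; first exact: lim.
  exact: cvg_cst.
move/cvg_pinftyP => lim1.
suff H : (fun t => (((v (t + h) - v t) / t ^+ j * c^-1)%R)%:E) @ +oo --> 1%E.
  apply: cvg_trans H; apply: near_eq_cvg; exists 1; split; first exact: num_real.
  move=> t /= t1; have t0 : 0 < t by lra.
  rewrite !VE; [|lra|lra].
  have f0 : 0 < j`!%:R :> R by rewrite ltr0n fact_gt0.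
  have mj0 : 0 < m ^+ j.+1 by exact: exprn_gt0.
  have tj0 : 0 < t ^+ j by exact: exprn_gt0.
  have den0 : 0 < h * t ^+ j / (j`!%:R * m ^+ j.+1) by rewrite divr_gt0// mulr_gt0.
  rewrite inver gt_eqF// -EFinB -EFinM; congr EFin; rewrite /c.
  move: f0 mj0 tj0; move: (j`!%:R) (m ^+ j.+1) (t ^+ j) => x y z x0 y0 z0.
  by field; rewrite !gt_eqF.
apply: cvg_EFin; first exact: nearW.
exact/cvg_pinftyP.
Qed.
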